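(* Let $\mathfrak t_n$, $n\in\mathbb N$, be semibounded sesquilinear forms in a complex Hilbert space $\mathfrak H$ with $\mathfrak t_m\le\mathfrak t_n$ for $m\le n$; let $c\in\mathbb R$ be a lower bound for $\mathfrak t_1$ (hence for all $\mathfrak t_n$) and let $\mathfrak t_n[\varphi,\psi]=c(\varphi,\psi)+(Q_n\varphi,Q_n\psi)$, $\varphi,\psi\in\operatorname{dom}\mathfrak t_n=\operatorname{dom}Q_n$, with linear operators $Q_n$ from $\mathfrak H$ to Hilbert spaces $\mathfrak K_n$. Let the semibounded form $\mathfrak t$ be the limit of $\mathfrak t_n$, represented as $\mathfrak t[\varphi,\psi]=c(\varphi,\psi)+(Q\varphi,Q\psi)$, $\varphi,\psi\in\operatorname{dom}\mathfrak t=\operatorname{dom}Q$, with a linear operator $Q$ from $\mathfrak H$ to a Hilbert space $\mathfrak K$. Let $\mathfrak r_n=\mathfrak t_{n,\rm reg}$ and $\mathfrak t_{\rm reg}$ be the regular parts. Then: (A) The regular parts satisfy $\mathfrak r_m\le\mathfrak r_n$ for $m\le n$, and $\mathfrak r_n\le\mathfrak t_{\rm reg}$. Moreover, there is a closable semibounded form $\mathfrak t_{\rm r}$ in $\mathfrak H$, represented as $\mathfrak t_{\rm r}[\varphi,\psi]=c(\varphi,\psi)+(Q_{\rm r}\varphi,Q_{\rm r}\psi)$, $\varphi,\psi\in\operatorname{dom}\mathfrak t_{\rm r}=\operatorname{dom}Q_{\rm r}$, with a closable operator $Q_{\rm r}$ from $\mathfrak H$ to a Hilbert space, such that $$\operatorname{dom}\mathfrak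 t_{\rm r}=\Big\{\varphi\in\bigcap_{n\in\mathbb N}\operatorname{dom}\mathfrak t_n:\ \sup_{n\in\mathbb N}\mathfrak r_n[\varphi]<\infty\Big\},$$ and which satisfies $$\mathfrak r_n\le\mathfrak t_{\rm r}\le\mathfrak t_{\rm reg}\quad\text{and}\quad\mathfrak r_n[\varphi]\nearrow\mathfrak t_{\rm r}[\varphi],\quad\varphi\in\operatorname{dom}\mathfrak t_{\rm r}.$$ (B) The closures $\bar{\mathfrak r}_n$ of the regular parts $\mathfrak r_n$ satisfy $\bar{\mathfrak r}_m\le\bar{\mathfrak r}_n$ for $m\le n$, and $\bar{\mathfrak r}_n\le\operatorname{clos}\mathfrak t_{\rm r}$. Moreover, there exists a closed semibounded form $\mathfrak s_{\rm r}$ in $\mathfrak H$, represented as $\mathfrak s_{\rm r}[\varphi,\psi]=c(\varphi,\psi)+(S_{\rm r}\varphi,S_{\rm r}\psi)$, $\varphi,\psi\in\operatorname{dom}\mathfrak s_{\rm r}=\operatorname{dom}S_{\rm r}$, with a closed operator $S_{\rm r}$ from $\mathfrak H$ to a Hilbert space, such that $$\operatorname{dom}\mathfrak s_{\rm r}=\Big\{\varphi\in\bigcap_{n\in\mathbb N}\operatorname{dom}\bar{\mathfrak r}_n:\ \sup_{n\in\mathbb N}\bar{\mathfrak r}_n[\varphi]<\infty\Big\},$$ and which satisfies $$\bar{\mathfrak r}_n\le\mathfrak s_{\rm r}\le\operatorname{clos}\mathfrak t_{\rm r}\quad\text{and}\quad\bar{\mathfrak r}_n[\varphi]\nearrow\mathfrak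 s_{\rm r}[\varphi],\quad\varphi\in\operatorname{dom}\mathfrak s_{\rm r}.$$ In fact, $\operatorname{dom}(\operatorname{clos}\mathfrak t_{\rm r})\subset\operatorname{dom}\mathfrak s_{\rm r}$ and $$(\operatorname{clos}\mathfrak t_{\rm r})[\varphi,\psi]=\mathfrak s_{\rm r}[\varphi,\psi],\qquad\varphi,\psi\in\operatorname{dom}(\operatorname{clos}\mathfrak t_{\rm r}).$$ (C) The semibounded selfadjoint relations $\widetilde A_{\mathfrak t_n}$ in $\mathfrak H$ corresponding to the semibounded forms $\mathfrak t_n$ converge to the semibounded selfadjoint relation $A_{\mathfrak s_{\rm r}}$ in $\mathfrak H$ corresponding to the closed semibounded form $\mathfrak s_{\rm r}$: $$\widetilde A_{\mathfrak t_n}\to A_{\mathfrak s_{\rm r}}$$ in the strong resolvent sense or, equivalently, the strong graph sense in $\mathfrak H$.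
   Context: A (sesquilinear) form $\mathfrak t$ in $\mathfrak H$ is a map $\operatorname{dom}\mathfrak t\times\operatorname{dom}\mathfrak t\to\mathbb C$, linear in the first and antilinear in the second entry, where $\operatorname{dom}\mathfrak t$ is a (not necessarily dense) linear subspace of $\mathfrak H$; $\mathfrak t[\varphi]=\mathfrak t[\varphi,\varphi]$. It is semibounded if there is $c\in\mathbb R$ (a lower bound) with $\mathfrak t[\varphi]\ge c\|\varphi\|^2$ on $\operatorname{dom}\mathfrak t$. $\mathfrak t_1\le\mathfrak t_2$ means $\operatorname{dom}\mathfrak t_2\subset\operatorname{dom}\mathfrak t_1$ and $\mathfrak t_1[\varphi]\le\mathfrak t_2[\varphi]$ for $\varphi\in\operatorname{dom}\mathfrak t_2$. $\varphi_n\to_{\mathfrak t}\varphi$ means $\varphi_n\in\operatorname{dom}\mathfrak t$, $\varphi_n\to\varphi$ in $\mathfrak H$ and $\mathfrak t[\varphi_n-\varphi_m]\to0$. The form is closable if $\varphi_n\to_{\mathfrak t}0$ implies $\mathfrak t[\varphi_n]\to0$, closed if $\varphi_n\to_{\mathfrak t}\varphi$ implies $\varphi\in\operatorname{dom}\mathfrak t$ and $\mathfrak t[\varphi_n-\varphi]\to0$; the closure $\bar{\mathfrak t}=\operatorname{clos}\mathfrak t$ of a closable semibounded form is its smallest closed extension. $a_n\nearrow a$ denotes nondecreasing convergence of real numbers. Limit of the nondecreasing sequence: $\mathfrak t$ is the unique semibounded form with $\operatorname{dom}\mathfrak t=\{\varphi\in\bigcap_n\operatorname{dom}\mathfrak t_n:\sup_n\mathfrak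 t_n[\varphi]<\infty\}$ and $\mathfrak t_n[\varphi]\nearrow\mathfrak t[\varphi]$ for $\varphi\in\operatorname{dom}\mathfrak t$. Regular part: for a semibounded form $\mathfrak t$ with $\mathfrak t[\varphi,\psi]=c(\varphi,\psi)+(Q\varphi,Q\psi)$, $\operatorname{dom}Q=\operatorname{dom}\mathfrak t$, let $Q^{**}$ be the closure of the graph of $Q$, $\operatorname{mul}Q^{**}=\{\omega:\{0,\omega\}\in Q^{**}\}$, $P_0$ the orthogonal projection onto $\operatorname{mul}Q^{**}$ and $Q_{\rm reg}=(I-P_0)Q$ (a closable operator). Then $\mathfrak t_{\rm reg}[\varphi,\psi]=c(\varphi,\psi)+(Q_{\rm reg}\varphi,Q_{\rm reg}\psi)$ on $\operatorname{dom}\mathfrak t_{\rm reg}=\operatorname{dom}\mathfrak t$; it is closable and independent of the choice of $c$ and $Q$, with closure $c(\varphi,\psi)+((Q_{\rm reg})^{**}\varphi,(Q_{\rm reg})^{**}\psi)$ on $\operatorname{dom}(Q_{\rm reg})^{**}$. A linear relation in $\mathfrak H$ is a linear subspace $T$ of $\mathfrak H\times\mathfrak H$; its adjoint is $T^*=\{\{k,h\}:(h,f)=(k,g)\text{ for all }\{f,g\}\in T\}$, and $T$ is selfadjoint if $T=T^*$. For a semibounded form $\mathfrak t$, $\widetilde A_{\mathfrak t}$ is the unique selfadjoint relation such that for each $\{\varphi,\varphi'\}\in\widetilde A_{\mathfrak t}$ there is a sequence $\varphi_n\in\operatorname{dom}\mathfrak t$ with $\varphi_n\to_{\mathfrak t}\varphi$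 and $\mathfrak t[\varphi_n,\psi]\to(\varphi',\psi)$ for all $\psi\in\operatorname{dom}\mathfrak t$; equivalently $\widetilde A_{\mathfrak t}=Q^*Q^{**}+c$ for any representation $\mathfrak t[\varphi,\psi]=c(\varphi,\psi)+(Q\varphi,Q\psi)$, $\varphi,\psi\in\operatorname{dom}\mathfrak t=\operatorname{dom}Q$, with $c\in\mathbb R$ a lower bound of $\mathfrak t$ and $Q$ a linear operator from $\mathfrak H$ to a Hilbert space (products and adjoints of relations). For a closed semibounded form $\mathfrak s$, $A_{\mathfrak s}$ is the unique selfadjoint relation with $\operatorname{dom}A_{\mathfrak s}\subset\operatorname{dom}\mathfrak s$ and $\mathfrak s[\varphi,\psi]=(\varphi',\psi)$ for all $\{\varphi,\varphi'\}\in A_{\mathfrak s}$, $\psi\in\operatorname{dom}\mathfrak s$. Selfadjoint relations $A_n$ converge to a selfadjoint relation $A$ in the strong resolvent sense if $(A_n-\lambda)^{-1}f\to(A-\lambda)^{-1}f$ for all $f\in\mathfrak H$ and $\lambda\in\mathbb C\setminus\mathbb R$; in the strong graph sense if every $\{f,f'\}\in A$ is the limit in $\mathfrak H\times\mathfrak H$ of a sequence $\{f_n,f_n'\}\in A_n$. *)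

(* Defs.v *)
From HB Require Import structures.
From mathcomp Require Import all_boot all_order all_algebra.
From mathcomp Require Import all_classical all_reals all_analysis.
From mathcomp Require Import complex.

Set Implicit Arguments.
Unset Strict Implicit.
Unset Printing Implicit Defensive.

Import Order.TTheory GRing.Theory Num.Theory.
Import numFieldNormedType.Exports.

Local Open Scope classical_set_scope.
Local Open Scope ring_scope.
Local Open Scope complex_scope.

(* [hdot] is linear in its first argument and antilinear in the second. *)
HB.mixin Record isHilbert (R : realType) V & CompleteNormedModule R[i] V := {
  hdot : {dot V for Num.conj};
  hdotxx : forall x : V, hdot x x = `|x| ^+ 2
}.

#[short(type="hilbertType")]
HB.structure Definition Hilbert (R : realType) :=
  {V of isHilbert R V & CompleteNormedModule R[i] V}.

Notation "''[' u , v ]" := (hdot u v) : ring_scope.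

(* The order of R[i] is partial: z <= w means that w - z is a nonnegative real,
   so each inequality between complex numbers below also says that the
   difference is real.  The topology of the complex plane is carried by the
   regular module R[i]^o. *)

Section Linear.
Variable R : realType.

Definition linear_subset (V : lmodType R[i]) (D : set V) : Prop :=
  D 0 /\ forall (a : R[i]) (u v : V), D u -> D v -> D (a *: u + v).

End Linear.

Section Forms.
Variables (R : realType) (H : hilbertType R).

(* The values of [fval] outside [fdom] are irrelevant: no definition below
   looks at them.  Sesquilinearity is the predicate [is_form]. *)
Record sesqform := SesqForm {
  fdom : set H;
  fval :> H -> H -> R[i]
}.

HB.instance Definition _ := gen_eqMixin sesqform.
HB.instance Definition _ := gen_choiceMixin sesqform.

Definition is_form (t : sesqform) : Prop :=
  [/\ linear_subset (fdom t),
      forall (a : R[i]) (u v w : H), fdom t u -> fdom t v -> fdom t w ->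
        t (a *: u + v) w = a * t u w + t v w
    & forall (a : R[i]) (u v w : H), fdom t u -> fdom t v -> fdom t w ->
        t w (a *: u + v) = Num.conj a * t w u + t w v].

Definition lower_bound (c : R) (t : sesqform) : Prop :=
  forall phi, fdom t phi -> c%:C * `|phi| ^+ 2 <= t phi phi.

Definition semibounded (t : sesqform) : Prop :=
  is_form t /\ exists c : R, lower_bound c t.

Definition form_le (t1 t2 : sesqform) : Prop :=
  fdom t2 `<=` fdom t1 /\ forall phi, fdom t2 phi -> t1 phi phi <= t2 phi phi.

Definition form_cvg (t : sesqform) (u : nat -> H) (phi : H) : Prop :=
  [/\ forall n, fdom t (u n),
      u n @[n --> \oo] --> phi
    & t (u p.1 - u p.2) (u p.1 - u p.2) @[p --> (\oo, \oo)]
        --> (0 : R[i]^o)].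

Definition closable_form (t : sesqform) : Prop :=
  forall u : nat -> H, form_cvg t u 0 ->
    t (u n) (u n) @[n --> \oo] --> (0 : R[i]^o).

Definition closed_form (t : sesqform) : Prop :=
  forall (u : nat -> H) (phi : H), form_cvg t u phi ->
    fdom t phi /\ t (u n - phi) (u n - phi) @[n --> \oo] --> (0 : R[i]^o).

Definition form_ext (t s : sesqform) : Prop :=
  fdom t `<=` fdom s /\
  forall phi psi, fdom t phi -> fdom t psi -> t phi psi = s phi psi.

Definition is_closure (t s : sesqform) : Prop :=
  [/\ semibounded s, closed_form s, form_ext t s
    & forall s', semibounded s' -> closed_form s' -> form_ext t s' ->
        form_ext s s'].

(* The smallest closed semibounded extension; when [t] is semibounded and
   closable it exists, and is unique up to values off its domain. *)
Definition clos (t : sesqform) : sesqform := xget t (is_closure t).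

Definition sup_finite (t : nat -> sesqform) (phi : H) : Prop :=
  exists M : R, forall n, t n phi phi <= M%:C.

Definition increases_to (a : nat -> R[i]) (l : R[i]) : Prop :=
  nondecreasing_seq a /\ a n @[n --> \oo] --> (l : R[i]^o).

Definition is_form_limit (t_ : nat -> sesqform) (t : sesqform) : Prop :=
  [/\ semibounded t,
      fdom t = [set phi | (\bigcap_n fdom (t_ n)) phi /\ sup_finite t_ phi]
    & forall phi, fdom t phi ->
        increases_to (fun n => t_ n phi phi) (t phi phi)].

End Forms.

Section Operators.
Variables (R : realType) (H K : hilbertType R).

(* A partially defined map; as for forms, [ofun] is irrelevant off [odom]. *)
Record operator := Operator {
  odom : set H;
  ofun :> H -> K
}.

Definition linear_op (Q : operator) : Prop :=
  linear_subset (odom Q) /\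
  forall (a : R[i]) (u v : H), odom Q u -> odom Q v ->
    Q (a *: u + v) = a *: Q u + Q v.

Definition graph (Q : operator) : set (H * K) :=
  [set p | odom Q p.1 /\ p.2 = Q p.1].

Definition mul (T : set (H * K)) : set K := [set omega | T (0, omega)].

Definition closable_op (Q : operator) : Prop :=
  mul (closure (graph Q)) = [set 0].

Definition closed_op (Q : operator) : Prop := closed (graph Q).

(* The y in M with x - y orthogonal to M; it exists and is unique when M is a
   closed linear subspace. *)
Definition orthproj (M : set K) (x : K) : K :=
  xget 0 [set y | M y /\ forall z, M z -> '[x - y, z] = 0].

Definition reg_op (Q : operator) : operator :=
  Operator (odom Q) (fun phi => Q phi - orthproj (mul (closure (graph Q))) (Q phi)).

Definition op_form (c : R) (Q : operator) : sesqform H :=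
  SesqForm (odom Q) (fun phi psi => c%:C * '[phi, psi] + '[Q phi, Q psi]).

Definition represents (t : sesqform H) (c : R) (Q : operator) : Prop :=
  fdom t = odom Q /\
  forall phi psi, fdom t phi -> fdom t psi ->
    t phi psi = c%:C * '[phi, psi] + '[Q phi, Q psi].

(* The regular part of a form represented by c and Q. *)
Definition reg_form (c : R) (Q : operator) : sesqform H :=
  op_form c (reg_op Q).

End Operators.

Section Relations.
Variables (R : realType) (H : hilbertType R).

Definition adjoint (T : set (H * H)) : set (H * H) :=
  [set p | forall q, T q -> '[p.2, q.1] = '[p.1, q.2]].

Definition selfadjoint (T : set (H * H)) : Prop :=
  linear_subset T /\ T = adjoint T.

Definition semibounded_rel (T : set (H * H)) : Prop :=
  exists c : R, forall p, T p -> c%:C * `|p.1| ^+ 2 <= '[p.2, p.1].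

(* The default value set0 of the two choices below is not a linear relation,
   hence not selfadjoint. *)
Definition is_form_rel (t : sesqform H) (A : set (H * H)) : Prop :=
  selfadjoint A /\
  forall p, A p -> exists2 u : nat -> H, form_cvg t u p.1 &
    forall psi, fdom t psi ->
      t (u n) psi @[n --> \oo] --> ('[p.2, psi] : R[i]^o).

Definition form_rel (t : sesqform H) : set (H * H) := xget set0 (is_form_rel t).

Definition is_closed_form_rel (s : sesqform H) (A : set (H * H)) : Prop :=
  selfadjoint A /\
  forall p, A p -> fdom s p.1 /\
    forall psi, fdom s psi -> s p.1 psi = '[p.2, psi].

Definition closed_form_rel (s : sesqform H) : set (H * H) :=
  xget set0 (is_closed_form_rel s).

(* (A - l)^-1 f, that is, the h with (h, f) in A - l; it exists and is unique
   when A is selfadjoint and l is not real. *)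
Definition resolvent (A : set (H * H)) (l : R[i]) (f : H) : H :=
  xget 0 [set h | A (h, f + l *: h)].

Definition strong_resolvent_cvg (A_ : nat -> set (H * H)) (A : set (H * H)) :
    Prop :=
  [/\ forall n, selfadjoint (A_ n), selfadjoint A
    & forall (f : H) (l : R[i]), l \isn't Num.real ->
        resolvent (A_ n) l f @[n --> \oo] --> resolvent A l f].

Definition strong_graph_cvg (A_ : nat -> set (H * H)) (A : set (H * H)) :
    Prop :=
  [/\ forall n, selfadjoint (A_ n), selfadjoint A
    & forall p, A p -> exists2 u : nat -> H * H,
        forall n, A_ n (u n) & u n @[n --> \oo] --> p].

End Relations.

(* Main.v *)
Require Import Defs.
From HB Require Import structures.
From mathcomp Require Import all_boot all_order all_algebra.
From mathcomp Require Import all_classical all_reals all_analysis.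
From mathcomp Require Import complex.
From mathcomp Require Import ring lra.

Set Implicit Arguments.
Unset Strict Implicit.
Unset Printing Implicit Defensive.

Import Order.TTheory GRing.Theory Num.Theory.
Import numFieldNormedType.Exports.

Local Open Scope classical_set_scope.
Local Open Scope ring_scope.
Local Open Scope complex_scope.

(* Every nonnegative form is |j phi|^2 for a linear map j into a Hilbert space,
   its completion, so all forms can be treated through operators.  Minimizing
   |f - psi|^2 + |Q psi|^2 over dom Q yields both the orthogonal projections
   and the resolvents at c - 1; since a symmetric relation A with A - (c - 1)
   onto is selfadjoint, the relation A_Q = Q^* Q^** + c is selfadjoint.
   Elements of A_Q only see the part of Q^** orthogonal to mul Q^**, hence
   A_Q = A_T for T the closure of the regular part of Q, and only the monotone
   sequence of closed operators T_n matters.  Its limit S is closed; t_r is the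
   restriction of s_r to the intersection of the domains dom t_n.  The minimal
   values at c - 1 increase with n, which makes the minimizers
   x_n = (A_{T_n} - (c - 1))^-1 f a Cauchy sequence whose limit minimizes the
   functional of S.  This is graph convergence, and the bound
   |Im l| |x| <= |y - l x| on selfadjoint relations turns it into resolvent
   convergence at every nonreal l. *)

(** The intersection of the domains need not be a core for the limit of the closures: if t_n is the
    zero form on dense subspaces D_n that decrease to {0}, then dom t_r = {0} while s_r is the zero
    form on the whole space. In general clos t_r is thus only a restriction of s_r, and the
    relations must be followed through the closures T_n and not through t_r. The point c - 1 is
    chosen because A_Q - (c - 1) belongs to the form (phi, psi) + (Q phi, Q psi), the inner product
    of the graph of Q, so that minimizers exist by completeness of the graph closure. At this real
    point the resolvents are variational, and the order of the forms can act on them; at nonreal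
    points there is no order to use. The closures, projections and relations of the statement are
    choices of an object with a given property, so each needs an explicit candidate and a reason for
    uniqueness; for relations the reason is that a selfadjoint relation has no proper selfadjoint
    extension. *)

Local Notation Re := complex.Re.
Local Notation Im := complex.Im.
Local Notation mul := Defs.mul.

(** * Complex scalars and their real parts *)

Section ComplexScalars.
Variable R : realType.
Implicit Types z w : R[i].

Lemma conjE z : Num.conj z = z^*%C.
Proof. by []. Qed.

Lemma ReD z w : Re (z + w) = Re z + Re w.
Proof. by case: z w => [? ?] [? ?]. Qed.

Lemma ReN z : Re (- z) = - Re z.
Proof. by case: z. Qed.

Lemma ReB z w : Re (z - w) = Re z - Re w.
Proof. by rewrite ReD ReN. Qed.

Lemma ReZ (a : R) z : Re (a%:C * z) = a * Re z.
Proof. by case: z => x y /=; rewrite mul0r subr0. Qed.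

Lemma Re_conjc z : Re (Num.conj z) = Re z.
Proof. by rewrite conjE; case: z. Qed.

Lemma ge0_complexE z : 0 <= z -> z = (Re z)%:C.
Proof. by move=> z0; rewrite RRe_real ?ger0_real. Qed.

Lemma ge0_Re z : 0 <= z -> 0 <= Re z.
Proof. by move=> z0; rewrite -ler0c -ge0_complexE. Qed.

Lemma conj_sqr z : z * Num.conj z = `|z| ^+ 2.
Proof. by rewrite sqr_normc. Qed.

Lemma Re_conjZ (a : R) z w :
  Re (Num.conj (a%:C * z) * w) = a * Re (Num.conj z * w).
Proof. by rewrite !conjE; case: z w => [? ?] [? ?] /=; ring. Qed.

Lemma Re_mulconj z : Re (Num.conj z * z) = Re (`|z| ^+ 2).
Proof. by rewrite mulrC conj_sqr. Qed.

Lemma norm_le_sqr z (a : R) : 0 <= a ->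
  `|z| ^+ 2 <= (a ^+ 2)%:C -> `|z| <= a%:C.
Proof.
move=> a0; rewrite (ge0_complexE (normr_ge0 z)).
set b := Re _; have b0 : 0 <= b by rewrite ge0_Re.
have -> : b%:C ^+ 2 = (b ^+ 2)%:C by rewrite rmorphXn.
by rewrite !lecR ler_pXn2r.
Qed.

Lemma Re_le_norm z : (Re z)%:C <= `|z|.
Proof.
by apply: le_trans (normc_ge_Re _); rewrite lecR ler_norm.
Qed.

End ComplexScalars.

(** * Real-valued norms and convergent sequences *)

Section RealNorm.
Variables (R : realType).

(** The norm takes values in [R[i]]; its real part carries the same information and gives access to
    the order, suprema and limits of [R]. *)
Definition rn (V : normedModType R[i]) (x : V) : R := Re `|x|.

Variable V : normedModType R[i].
Implicit Types x y : V.

Lemma rnE x : `|x| = (rn x)%:C.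
Proof. by rewrite /rn -ge0_complexE. Qed.

Lemma rn_ge0 x : 0 <= rn x.
Proof. by rewrite /rn ge0_Re. Qed.

Lemma rn0 : rn (0 : V) = 0.
Proof. by rewrite /rn normr0. Qed.

Lemma rn_eq0 x : rn x = 0 -> x = 0.
Proof. by move=> x0; apply/eqP; rewrite -normr_eq0 rnE x0. Qed.

Lemma rnN x : rn (- x) = rn x.
Proof. by rewrite /rn normrN. Qed.

Lemma rnB x y : rn (x - y) = rn (y - x).
Proof. by rewrite -rnN opprB. Qed.

Lemma rnD x y : rn (x + y) <= rn x + rn y.
Proof.
by have := ler_normD x y; rewrite !rnE -rmorphD lecR.
Qed.

Lemma rn_triangle x y z : rn (x - z) <= rn (x - y) + rn (y - z).
Proof. by have := rnD (x - y) (y - z); rewrite addrA subrK. Qed.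

Lemma rnZ (a : R[i]) x : rn (a *: x) = rn (a : R[i]^o) * rn x.
Proof. by rewrite /rn normrZ [in LHS](ge0_complexE (normr_ge0 a)) ReZ. Qed.

Lemma rn_dist x y : `|rn x - rn y| <= rn (x - y).
Proof.
rewrite ler_norml; apply/andP; split.
  have := rnD (y - x) x; rewrite subrK rnB; lra.
have := rnD (x - y) y; rewrite subrK; lra.
Qed.

Lemma cvgnP (u : nat -> V) x : u n @[n --> \oo] --> x <->
  forall e : R, 0 < e -> exists N, forall n, (N <= n)%N -> rn (u n - x) < e.
Proof.
split=> [/cvgrPdist_lt ux e e0|ux].
  have := ux e%:C; rewrite ltcR => /(_ e0) [N _ Nx]; exists N => n nN.
  by have := Nx n nN; rewrite /= rnE rnB ltcR.
apply/cvgrPdist_lt => e e0.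
have e0' : 0 < Re e by rewrite -ltcR -ge0_complexE ?ltW.
have [N Nx] := ux _ e0'; exists N => //= n nN.
by rewrite rnE rnB (ge0_complexE (ltW e0)) ltcR Nx.
Qed.

Lemma cvg_rn (u : nat -> V) x : u n @[n --> \oo] --> x ->
  rn (u n) @[n --> \oo] --> rn x.
Proof.
move=> /cvgnP ux; apply/cvgrPdist_lt => e e0.
have [N Nx] := ux _ e0; exists N => //= n nN.
by apply: le_lt_trans (Nx _ nN); rewrite distrC rn_dist.
Qed.

Lemma cvg_rn0 (u : nat -> V) x : u n @[n --> \oo] --> x <->
  rn (u n - x) @[n --> \oo] --> (0 : R).
Proof.
split=> [ux|/cvgrPdist_lt ux].
  rewrite -rn0 -(subrr x); apply: cvg_rn.
  by apply: cvgB => //; apply: cvg_cst.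
apply/cvgnP => e e0; have [N _ Nx] := ux _ e0; exists N => n nN.
by have := Nx _ nN; rewrite /= sub0r normrN ger0_norm ?rn_ge0.
Qed.

Definition cauchyn (u : nat -> V) := forall e : R, 0 < e ->
  exists N, forall m n, (N <= m)%N -> (N <= n)%N -> rn (u m - u n) < e.

Lemma cvg_cauchyn (u : nat -> V) x : u n @[n --> \oo] --> x -> cauchyn u.
Proof.
move=> /cvgnP ux e e0; have [N Nx] := ux (e / 2) ltac:(lra).
exists N => m n Nm Nn; apply: (le_lt_trans (rn_triangle _ x _)).
rewrite [rn (x - _)]rnB; have := Nx _ Nm; have := Nx _ Nn; lra.
Qed.

Lemma cvg_rn_le (u : nat -> V) x y (M : R) : u n @[n --> \oo] --> x ->
  (exists N, forall n, (N <= n)%N -> rn (u n - y) <= M) -> rn (x - y) <= M.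
Proof.
move=> /cvgnP ux [N uM]; apply/ler_addgt0Pr => e e0.
have [N' uN'] := ux _ e0.
have := uM _ (leq_maxl N N'); have := uN' _ (leq_maxr N N').
have := rn_triangle x (u (maxn N N')) y; rewrite (rnB x (u _)); lra.
Qed.

Lemma cvg_rn_small (u v : nat -> V) x : u n @[n --> \oo] --> x ->
  (forall e : R, 0 < e -> exists N, forall n, (N <= n)%N ->
     rn (v n - u n) < e) -> v n @[n --> \oo] --> x.
Proof.
move=> /cvgnP ux uv; apply/cvgnP => e e0.
have [N uN] := ux (e / 2) ltac:(lra); have [N' vN] := uv (e / 2) ltac:(lra).
exists (maxn N N') => n; rewrite geq_max => /andP[nN nN'].
have := uN _ nN; have := vN _ nN'; have := rn_triangle (v n) (u n) x; lra.
Qed.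

Lemma cvgn_unique (u : nat -> V) x y : u n @[n --> \oo] --> x ->
  u n @[n --> \oo] --> y -> x = y.
Proof.
move=> ux uy; apply/eqP; rewrite -subr_eq0; apply/eqP/rn_eq0/eqP.
rewrite eq_le rn_ge0 andbT; apply/ler_addgt0Pr => e e0; rewrite add0r.
apply: cvg_rn_le ux _; have [N uN] := (cvgnP u y).1 uy _ e0.
by exists N => n nN; rewrite ltW ?uN.
Qed.

Lemma cvgn_comb (a : R[i]) (u v : nat -> V) x y : u n @[n --> \oo] --> x ->
  v n @[n --> \oo] --> y -> (a *: u n + v n) @[n --> \oo] --> a *: x + y.
Proof.
move=> ux vy; have au : a *: u n @[n --> \oo] --> a *: x.
  by apply: cvgZ ux; apply: cvg_cst.
exact: cvgD au vy.
Qed.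

Lemma cvgn_sub (u v : nat -> V) x y : u n @[n --> \oo] --> x ->
  v n @[n --> \oo] --> y -> (u n - v n) @[n --> \oo] --> x - y.
Proof. by move=> ux vy; apply: cvgB. Qed.

End RealNorm.
Arguments rn {R V} x.

(** * Completeness and limits of scalar sequences *)

Lemma cauchyn_cvg (R : realType) (V : completeNormedModType R[i])
  (u : nat -> V) : cauchyn u -> exists x : V, u n @[n --> \oo] --> x.
Proof.
move=> cu; apply/(cvg_ex (u @ \oo)).
apply: cauchy_cvg; apply/cauchyP => e e0.
have e0' : 0 < Re e by rewrite -ltcR -ge0_complexE ?ltW.
have [N Nu] := cu _ e0'; exists (u N); exists N => // n /= nN.
by rewrite -ball_normE /= rnE (ge0_complexE (ltW e0)) ltcR Nu.
Qed.

(** Real and imaginary parts are bounded by the modulus, so completeness of [R] applies to each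
    coordinate. *)
Lemma cauchyn_cvgC (R : realType) (z : nat -> R[i]^o) : cauchyn z ->
  exists w : R[i]^o, z n @[n --> \oo] --> w.
Proof.
move=> cz.
have reim (w : R[i]^o) : `|Re w| <= rn w /\ `|Im w| <= rn w.
  rewrite /rn [`|w|]normc_def /=.
  by split; rewrite -sqrtr_sqr ler_sqrt ?addr_ge0 ?sqr_ge0 // ?lerDl ?lerDr
    sqr_ge0.
have cau (f : R[i] -> R) : (forall w w', f (w - w') = f w - f w') ->
    (forall w : R[i]^o, `|f w| <= rn w) -> cvg (f (z n) @[n --> \oo]).
  move=> fB fle; apply/cauchy_cvgP/cauchyP => e e0.
  have [N Nz] := cz _ e0; exists (f (z N)); exists N => // n /= nN.
  rewrite -ball_normE /= -fB; apply: le_lt_trans (Nz _ _ (leqnn N) nN).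
  exact: fle.
have /cvg_ex[a za] := cau (@Re R) (@ReB R) (fun w => (reim w).1).
have ImB (w w' : R[i]) : Im (w - w') = Im w - Im w' by case: w w' => [? ?] [].
have /cvg_ex[b zb] := cau (@Im R) ImB (fun w => (reim w).2).
exists (a +i* b); apply/cvgnP => e e0.
move/cvgrPdist_lt : za => /(_ (e / 2) ltac:(lra)) [N _ Na].
move/cvgrPdist_lt : zb => /(_ (e / 2) ltac:(lra)) [M _ Nb].
exists (maxn N M) => n; rewrite geq_max => /andP[nN nM].
have := Na _ nN; have := Nb _ nM; rewrite /= => hb ha.
rewrite /rn [`|_|]normc_def /=.
rewrite -(@ger0_norm _ e) ?ltW // -sqrtr_sqr ltr_sqrt ?exprn_gt0 //.
have h1 : (Re (z n - (a +i* b)%C)) ^+ 2 < (e / 2) ^+ 2.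
  rewrite -ltr_sqrt ?exprn_gt0 ?divr_gt0 // !sqrtr_sqr.
  by rewrite ReB /= distrC [`|e / 2|]ger0_norm // divr_ge0 // ltW.
have h2 : (Im (z n - (a +i* b)%C)) ^+ 2 < (e / 2) ^+ 2.
  rewrite -ltr_sqrt ?exprn_gt0 ?divr_gt0 // !sqrtr_sqr.
  by rewrite ImB /= distrC [`|e / 2|]ger0_norm // divr_ge0 // ltW.
nra.
Qed.

Lemma cvgn_cst (T : topologicalType) (x : T) :
  (fun=> x : T) n @[n --> \oo] --> x.
Proof. exact: cvg_cst. Qed.

Arguments cvgn_cst {T} x.

Lemma cvg_real_le (R : realType) (a : nat -> R) (l M : R) :
  a n @[n --> \oo] --> l -> (exists N, forall n, (N <= n)%N -> a n <= M) ->
  l <= M.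
Proof.
move=> /cvgrPdist_lt al [N aM]; apply/ler_addgt0Pr => e e0.
have [N' _ aN] := al _ e0.
have := aM _ (leq_maxl N N'); have := aN _ (leq_maxr N N').
by rewrite /= ltr_norml => /andP[_]; lra.
Qed.

Lemma cvg_real_le2 (R : realType) (a b : nat -> R) (l m : R) :
  a n @[n --> \oo] --> l -> b n @[n --> \oo] --> m ->
  (exists N, forall n, (N <= n)%N -> a n <= b n) -> l <= m.
Proof.
move=> al bm [N abN]; rewrite -subr_le0.
apply: (@cvg_real_le _ (fun n => a n - b n)); first exact: cvgB al bm.
by exists N => n nN; rewrite subr_le0 abN.
Qed.

Lemma invSn_lt (R : realType) (e : R) : 0 < e ->
  exists N : nat, forall n, (N <= n)%N -> n.+1%:R^-1 < e.
Proof.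
move=> e0; have [N _ Nh] := near_infty_natSinv_lt (PosNum e0).
by exists N => n nN; have := Nh n nN.
Qed.

(** Stated for [m <= n] without absolute value: in the uses the increment is, or dominates, a
    squared seminorm. *)
Lemma bounded_mono_cauchy (R : realType) (a : nat -> R) (M e : R) :
  nondecreasing_seq a -> (forall n, a n <= M) -> 0 < e ->
  exists N, forall m n, (N <= m)%N -> (m <= n)%N -> a n - a m < e.
Proof.
move=> nd aM e0.
have [l /cvgrPdist_lt al] : exists l : R, a n @[n --> \oo] --> l.
  apply/(cvg_ex (a @ \oo)).
  by apply: nondecreasing_is_cvgn => //; exists M => _ [n _ <-].
have [N _ hN] := al (e / 2) (divr_gt0 e0 (ltr0Sn _ 1)).
exists N => m n Nm mn.
have := hN m Nm; have := hN n (leq_trans Nm mn); rewrite /= !ltr_norml.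
by move=> /andP[h1 h2] /andP[h3 h4]; lra.
Qed.

Section ComplexLimits.
Variable R : realType.
Implicit Types (z : nat -> R[i]^o) (w : R[i]^o).

Lemma rn_conj w : rn (Num.conj w : R[i]^o) = rn w.
Proof. by rewrite /rn norm_conjC. Qed.

Lemma rnM (w w' : R[i]^o) : rn (w * w' : R[i]^o) = rn w * rn w'.
Proof. exact: (rnZ w w'). Qed.

Lemma rn_real (a : R) : rn (a%:C : R[i]^o) = `|a|.
Proof. by rewrite /rn [`|_|]normc_def /= expr0n addr0 sqrtr_sqr. Qed.

Lemma Re_le_rn w : `|Re w| <= rn w.
Proof. by rewrite -lecR -rnE; apply: normc_ge_Re. Qed.

Lemma cvg_conj z w : z n @[n --> \oo] --> w ->
  (Num.conj (z n) : R[i]^o) @[n --> \oo] --> (Num.conj w : R[i]^o).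
Proof.
move=> /cvgnP zw; apply/cvgnP => e e0; have [N zN] := zw _ e0.
by exists N => n nN; rewrite -rmorphB rn_conj zN.
Qed.

(** A nonnegative [z n] equals its modulus; the modulus is continuous, so [w] equals its modulus too
    and is in particular real. *)
Lemma cvg_ge0 z w : (forall n, 0 <= z n) -> z n @[n --> \oo] --> w -> 0 <= w.
Proof.
move=> z0 /[dup] zw /cvgnP zw'.
suff /cvgn_unique/(_ zw) <- : z n @[n --> \oo] --> (`|w| : R[i]^o) by [].
apply/cvgnP => e e0; have [N zN] := zw' _ e0; exists N => n nN.
apply: le_lt_trans (zN _ nN); rewrite -lecR -!rnE.
by rewrite -[X in `|X - _|]ger0_norm //; apply: ler_dist_dist.
Qed.

Lemma cvg_Re z w : z n @[n --> \oo] --> w -> Re (z n) @[n --> \oo] --> Re w.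
Proof.
move=> /cvgnP zw; apply/cvgrPdist_lt => e e0; have [N zN] := zw _ e0.
exists N => // n nN; rewrite /= distrC -ReB.
exact: le_lt_trans (Re_le_rn _) (zN _ nN).
Qed.

Lemma cvg_real (a : nat -> R) (b : R) : a n @[n --> \oo] --> b ->
  ((a n)%:C : R[i]^o) @[n --> \oo] --> (b%:C : R[i]^o).
Proof.
move=> /cvgrPdist_lt ab; apply/cvgnP => e e0; have [N _ aN] := ab _ e0.
exists N => n nN; rewrite -rmorphB rn_real distrC; exact: aN.
Qed.

End ComplexLimits.

(** * Semi-inner products *)

(** Everything is relative to [D], since a form carries no information off its domain, and
    [g u u = 0] may hold for nonzero [u], as it does on the kernel of an operator. *)
Record semi_dot (R : realType) (M : lmodType R[i]) (D : set M)
    (g : M -> M -> R[i]) : Prop := SemiDot {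
  sdot_dom : linear_subset D;
  sdot_linear : forall a u v w, D u -> D v -> D w ->
    g (a *: u + v) w = a * g u w + g v w;
  sdot_conj : forall u v, D u -> D v -> g u v = Num.conj (g v u);
  sdot_ge0 : forall u, D u -> 0 <= g u u }.

Section LinearSubset.
Variables (R : realType) (M : lmodType R[i]) (D : set M).
Hypothesis linD : linear_subset D.

Lemma lin_subset0 : D 0. Proof. exact: linD.1. Qed.

Lemma lin_subsetD u v : D u -> D v -> D (u + v).
Proof. by move=> Du Dv; rewrite -(scale1r u); apply: linD.2. Qed.

Lemma lin_subsetZ a u : D u -> D (a *: u).
Proof.
by move=> Du; rewrite -[_ *: _]addr0; apply: linD.2 => //; case: linD.
Qed.

Lemma lin_subsetN u : D u -> D (- u).
Proof. by rewrite -scaleN1r; apply: lin_subsetZ. Qed.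

Lemma lin_subsetB u v : D u -> D v -> D (u - v).
Proof. by move=> Du Dv; apply: lin_subsetD => //; apply: lin_subsetN. Qed.

End LinearSubset.

Section SemiDot.
Variables (R : realType) (M : lmodType R[i]) (D : set M) (g : M -> M -> R[i]).
Hypothesis h : semi_dot D g.
Let linD := sdot_dom h.
Let gl := sdot_linear h.
Let gC := sdot_conj h.
Let g0 := sdot_ge0 h.

Lemma sdotD u v w : D u -> D v -> D w -> g (u + v) w = g u w + g v w.
Proof. by move=> Du Dv Dw; have := gl 1 Du Dv Dw; rewrite scale1r mul1r. Qed.

Lemma sdot0 w : D w -> g 0 w = 0.
Proof.
move=> Dw; have D0 := lin_subset0 linD.
by apply: (addrI (g 0 w)); rewrite -sdotD // !addr0.
Qed.

Lemma sdotZ a u w : D u -> D w -> g (a *: u) w = a * g u w.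
Proof.
move=> Du Dw; have := gl a Du (lin_subset0 linD) Dw.
by rewrite sdot0 // !addr0.
Qed.

Lemma sdotN u w : D u -> D w -> g (- u) w = - g u w.
Proof. by move=> Du Dw; rewrite -scaleN1r sdotZ // mulN1r. Qed.

Lemma sdotB u v w : D u -> D v -> D w -> g (u - v) w = g u w - g v w.
Proof.
by move=> Du Dv Dw; rewrite sdotD ?sdotN //; exact: lin_subsetN.
Qed.

Lemma sdotPr a u v w : D u -> D v -> D w ->
  g w (a *: u + v) = Num.conj a * g w u + g w v.
Proof.
move=> Du Dv Dw.
rewrite gC // ?gl //; last exact: linD.2.
by rewrite rmorphD rmorphM /= -!gC.
Qed.

Lemma sdotDr u v w : D u -> D v -> D w -> g w (u + v) = g w u + g w v.
Proof.
move=> Du Dv Dw; rewrite gC ?sdotD ?rmorphD /= -?gC //.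
exact: lin_subsetD.
Qed.

Lemma sdotZr a u w : D u -> D w -> g w (a *: u) = Num.conj a * g w u.
Proof.
move=> Du Dw; rewrite gC ?sdotZ ?rmorphM /= -?gC //.
exact: lin_subsetZ.
Qed.

Lemma sdotNr u w : D u -> D w -> g w (- u) = - g w u.
Proof.
move=> Du Dw; rewrite gC ?sdotN ?rmorphN /= -?gC //.
exact: lin_subsetN.
Qed.

Lemma sdotBr u v w : D u -> D v -> D w -> g w (u - v) = g w u - g w v.
Proof.
by move=> Du Dv Dw; rewrite sdotDr ?sdotNr //; exact: lin_subsetN.
Qed.

Lemma cauchy_schwarz_form u v : D u -> D v ->
  `|g u v| ^+ 2 <= g u u * g v v.
Proof.
move=> Du Dv; set z := g u v.
rewrite (ge0_complexE (g0 Du)) (ge0_complexE (g0 Dv)) -rmorphM.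
set a := Re (g u u); set b := Re (g v v).
have zz : `|z| ^+ 2 = (Re (`|z| ^+ 2))%:C.
  by rewrite -ge0_complexE // exprn_ge0.
rewrite zz lecR; set w := Re _.
have w0 : 0 <= w by rewrite ge0_Re // exprn_ge0.
(* Positivity of [g] at [u - s z v] for real [s]; the factor [z] makes the cross terms real. *)
have q0 (s : R) : 0 <= a - 2 * s * w + s ^+ 2 * w * b.
  have Dx : D ((- s%:C * z) *: v + u) by apply: linD.2.
  have := ge0_Re (g0 Dx).
  rewrite gl // sdotPr // sdotPr // !ReD.
  rewrite (gC Dv Du) -/z rmorphM rmorphN /=.
  rewrite [Num.conj s%:C](_ : _ = s%:C); last by rewrite conjE conjc_real.
  rewrite (_ : _ * z * _ = - s%:C * (z * Num.conj z) * (- s%:C) * g v v +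
    (- s%:C) * (z * Num.conj z)); last by ring.
  rewrite (_ : - s%:C * Num.conj z * z = - s%:C * (z * Num.conj z));
    last by ring.
  rewrite conj_sqr zz -/w (ge0_complexE (g0 Dv)) -/b.
  rewrite -rmorphN -!rmorphM -!rmorphD /= -/a => hh.
  apply: (le_trans hh); lra.
have a0 : 0 <= a by exact: ge0_Re (g0 Du).
have : 0 <= b by exact: ge0_Re (g0 Dv).
rewrite le_eqVlt => /predU1P[b0|b0].
  rewrite -b0 mulr0 leNgt; apply/negP => w0'.
  (* For [b = 0] the polynomial is affine in [s], and this [s] gives it the value [- a - 2]. *)
  have := q0 ((a + 1) / w).
  rewrite -b0 mulr0 addr0 -!mulrA mulVf ?gt_eqF //; lra.
(* The polynomial attains its minimum at [1 / b]. *)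
have := q0 b^-1.
have bn : b != 0 by rewrite gt_eqF.
rewrite (_ : a - _ + _ = a - w / b); last by field.
by rewrite subr_ge0 ler_pdivrMr.
Qed.

Definition fnorm u : R := Num.sqrt (Re (g u u)).

Lemma fnorm_ge0 u : 0 <= fnorm u.
Proof. exact: sqrtr_ge0. Qed.

Lemma sqr_fnorm u : D u -> fnorm u ^+ 2 = Re (g u u).
Proof. by move=> Du; rewrite sqr_sqrtr // ge0_Re // g0. Qed.

Lemma fnormE u : D u -> (fnorm u ^+ 2)%:C = g u u.
Proof. by move=> Du; rewrite sqr_fnorm // -ge0_complexE ?g0. Qed.

Lemma fnorm_lt u e : D u -> 0 < e -> (fnorm u < e) = (Re (g u u) < e ^+ 2).
Proof.
move=> Du e0; rewrite -(@ltr_pXn2r _ 2) ?nnegrE ?fnorm_ge0 ?ltW //.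
by rewrite sqr_fnorm.
Qed.

Lemma fnorm_cs u v : D u -> D v -> rn (g u v : R[i]^o) <= fnorm u * fnorm v.
Proof.
move=> Du Dv; rewrite -lecR -rnE.
apply: norm_le_sqr; first by rewrite mulr_ge0 ?fnorm_ge0.
by rewrite exprMn rmorphM /= !fnormE //; apply: cauchy_schwarz_form.
Qed.

Lemma fnorm0 : fnorm 0 = 0.
Proof. by rewrite /fnorm sdot0 ?sqrtr0 //; exact: lin_subset0 linD. Qed.

Lemma fnormN u : D u -> fnorm (- u) = fnorm u.
Proof.
by move=> Du; rewrite /fnorm sdotN ?sdotNr ?opprK //; exact: lin_subsetN.
Qed.

Lemma fnormZ (a : R[i]) u : D u -> fnorm (a *: u) = Re `|a| * fnorm u.
Proof.
move=> Du; have na : 0 <= Re `|a| by rewrite ge0_Re.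
apply/eqP; rewrite -(@eqrXn2 _ 2) ?mulr_ge0 ?fnorm_ge0 //.
apply/eqP/complexI; rewrite fnormE; last exact: lin_subsetZ.
rewrite sdotZ ?sdotZr //; last exact: lin_subsetZ.
rewrite mulrA conj_sqr exprMn rmorphM /= fnormE //.
by rewrite [in LHS](ge0_complexE (normr_ge0 a)) rmorphXn.
Qed.

Lemma fnormD u v : D u -> D v -> fnorm (u + v) <= fnorm u + fnorm v.
Proof.
move=> Du Dv; have Duv := lin_subsetD linD Du Dv.
rewrite -(@ler_pXn2r _ 2) ?nnegrE ?addr_ge0 ?fnorm_ge0 //.
have uvc : Re (g v u) = Re (g u v) by rewrite gC // Re_conjc.
rewrite sqr_fnorm // sdotD // !sdotDr // !ReD uvc -!sqr_fnorm // sqrrD.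
have : Re (g u v) <= fnorm u * fnorm v.
  apply: le_trans (fnorm_cs Du Dv).
  by rewrite -lecR -rnE Re_le_norm.
lra.
Qed.

Lemma fnormB u v : D u -> D v -> fnorm (u - v) = fnorm (v - u).
Proof.
by move=> Du Dv; rewrite -fnormN ?opprB //; exact: lin_subsetB.
Qed.

Lemma fnorm_triangle u v w : D u -> D v -> D w ->
  fnorm (u - w) <= fnorm (u - v) + fnorm (v - w).
Proof.
move=> Du Dv Dw; have := @fnormD (u - v) (v - w).
by rewrite addrA subrK; apply; exact: lin_subsetB.
Qed.

End SemiDot.

(** * Completion of a semi-inner product space *)

Record complete_dot (R : realType) (M : lmodType R[i])
    (g : M -> M -> R[i]) : Prop := CompleteDot {
  dot_linear : forall a u v w, g (a *: u + v) w = a * g u w + g v w;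
  dot_conj : forall u v, g u v = Num.conj (g v u);
  dot_gt0 : forall u, u != 0 -> 0 < g u u;
  dot_complete : forall x : nat -> M,
    (forall e : R, 0 < e -> exists N, forall m n, (N <= m)%N -> (N <= n)%N ->
       Re (g (x m - x n) (x m - x n)) < e) ->
    exists y, forall e : R, 0 < e -> exists N, forall n, (N <= n)%N ->
       Re (g (x n - y) (x n - y)) < e }.

(** A copy of [M] tagged with the proof [h], so that the norm and topology coming from [g] are
    attached to this copy and not to [M]. *)
Definition dot_space (R : realType) (M : lmodType R[i]) (g : M -> M -> R[i])
  of complete_dot g : Type := M.

Section DotSpace.
Variables (R : realType) (M : lmodType R[i]) (g : M -> M -> R[i]).
Hypothesis h : complete_dot g.
Local Notation V := (dot_space h).

HB.instance Definition _ := GRing.Lmodule.copy V M.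

Let sd : @semi_dot R V [set: V] g.
Proof.
split=> // [a u v w _ _ _|u v _ _|u _]; first exact: dot_linear h _ _ _ _.
  exact: dot_conj h _ _.
have [->|u0] := eqVneq u 0; last by rewrite ltW // (dot_gt0 h).
have e0 := dot_linear h 1 0 0 0; rewrite scale1r mul1r addr0 in e0.
by rewrite (_ : g 0 0 = 0) //; apply: (addrI (g 0 0)); rewrite addr0 -e0.
Qed.

Let cnrm (u : V) : R[i] := (@fnorm R V g u)%:C.

Let cnrmD (u v : V) : cnrm (u + v) <= cnrm u + cnrm v.
Proof. by rewrite /cnrm -rmorphD lecR (fnormD sd). Qed.

Let cnrmZ (a : R[i]) (u : V) : cnrm (a *: u) = `|a| * cnrm u.
Proof.
by rewrite /cnrm (fnormZ sd) // [in RHS](ge0_complexE (normr_ge0 a)) -rmorphM.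
Qed.

Let cnrm_eq0 (u : V) : cnrm u = 0 -> u = 0.
Proof.
move=> [nu0]; apply/eqP/negP => /negP u0; have := dot_gt0 h u0.
by rewrite -(fnormE sd) // nu0 expr0n ltxx.
Qed.

HB.instance Definition _ := @Lmodule_isNormed.Build R[i] V
  cnrm cnrmD cnrmZ cnrm_eq0.

Let normE (u : V) : `|u| = cnrm u. Proof. by []. Qed.

Let complete (F : set_system V) : ProperFilter F -> cauchy F -> cvg F.
Proof.
move=> FF /cauchyP cF.
(* Completeness concerns filters, [dot_complete] sequences: take centres of balls of radius
   [1 / (n + 1)] belonging to [F]. Any two of these balls meet, so the centres form a Cauchy
   sequence, and its limit is the limit of [F]. *)
have /choice[x xF] (n : nat) : exists x : V, F (ball x (n.+1%:R^-1%:C : R[i])).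
  by apply: cF; rewrite ltcR invr_gt0 ltr0n.
have xmn m n : @fnorm R V g (x m - x n) < m.+1%:R^-1 + n.+1%:R^-1.
  have [y []] := filter_ex (filterI (xF m) (xF n)).
  rewrite -!ball_normE /= !normE => h1 h2.
  rewrite -ltcR; have := cnrmD (x m - y) (y - x n).
  rewrite addrA subrK => h3; apply: (le_lt_trans h3).
  rewrite rmorphD; apply: ltrD => //.
  by rewrite -normE distrC.
have [|y xy] := dot_complete h (x := x).
  move=> e e0.
  have s0 : 0 < Num.sqrt e by rewrite sqrtr_gt0.
  have [N hN] := invSn_lt (divr_gt0 s0 (ltr0Sn _ 1)).
  exists N => m n Nm Nn.
  rewrite -(sqr_sqrtr (ltW e0)) -(fnorm_lt sd) //; apply: (lt_trans (xmn m n)).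
  by rewrite [X in _ < X]splitr ltrD ?hN.
apply/cvg_ex; exists y; apply/cvg_ballP => e e0.
have e0' : 0 < Re e by rewrite -ltcR -ge0_complexE ?ltW.
have [N1 h1] := invSn_lt (divr_gt0 e0' (ltr0Sn _ 1)).
have [N2 h2] := xy ((Re e / 2) ^+ 2) (exprn_gt0 2 (divr_gt0 e0' (ltr0Sn _ 1))).
pose n := maxn N1 N2.
apply: filterS (xF n) => z; rewrite -!ball_normE /= !normE.
have hn1 := h1 n (leq_maxl _ _); have := h2 n (leq_maxr _ _).
rewrite -(fnorm_lt sd) ?divr_gt0 // => hn2.
rewrite {1}/cnrm ltcR => hz.
rewrite (ge0_complexE (ltW e0)) /cnrm ltcR.
have := cnrmD (y - x n) (x n - z); rewrite addrA subrK /cnrm -rmorphD lecR.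
have -> : @fnorm R V g (y - x n) = @fnorm R V g (x n - y).
  exact: (fnormB sd).
move=> hd; apply: le_lt_trans hd _.
by rewrite [X in _ < X]splitr ltrD // (lt_trans hz).
Qed.

HB.instance Definition _ := Uniform_isComplete.Build V complete.

Let gB (w : V) : zmod_morphism (g ^~ w : V -> R[i]).
Proof. by move=> x y /=; rewrite (sdotB sd). Qed.
Let gBr (w : V) : zmod_morphism (g w : V -> R[i]).
Proof. by move=> x y /=; rewrite (sdotBr sd). Qed.
Let gZl (w : V) : scalable_for *%R (g ^~ w : V -> R[i]).
Proof. by move=> a x /=; rewrite (sdotZ sd). Qed.
Let gZr (w : V) : scalable_for (Num.conj \; *%R) (g w : V -> R[i]).
Proof. by move=> a x /=; rewrite (sdotZr sd). Qed.
Let gH (x y : V) : g x y = (-1) ^+ false * Num.conj (g y x).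
Proof. by rewrite expr0 mul1r (dot_conj h). Qed.

Definition dot_space_dot : V -> V -> R[i] := g.
HB.instance Definition _ := isBilinear.Build R[i] V V R[i] *%R
  (Num.conj \; *%R) dot_space_dot gB gBr gZl gZr.
HB.instance Definition _ := isHermitianSesquilinear.Build R[i] V false
  Num.conj dot_space_dot gH.
HB.instance Definition _ := isDotProduct.Build R[i] V dot_space_dot
  (dot_gt0 h).

Let dotxx (x : V) : dot_space_dot x x = `|x| ^+ 2.
Proof.
rewrite normE /dot_space_dot -(fnormE sd) // /cnrm.
exact: (rmorphXn (real_complex R)).
Qed.

HB.instance Definition _ := isHilbert.Build R V dotxx.

End DotSpace.

Section Completion.
Variables (R : realType) (E : lmodType R[i]) (D : set E) (q : E -> E -> R[i]).
Hypothesis h : semi_dot D q.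
Let linD := sdot_dom h.
Implicit Types (u v : nat -> E) (f g : E -> R[i]^o).

Definition fcauchy u := (forall n, D (u n)) /\ forall e : R, 0 < e ->
  exists N, forall m n, (N <= m)%N -> (N <= n)%N -> fnorm q (u m - u n) < e.

(* An element of the completion is represented by the functional
   [psi |-> lim q (u n) psi] on [D], extended by zero. *)
Definition gen u f := [/\ fcauchy u,
  forall psi, D psi -> (q (u n) psi : R[i]^o) @[n --> \oo] --> f psi
  & forall psi, ~ D psi -> f psi = 0].

Lemma fcauchy_bd u : fcauchy u ->
  exists B : R, 0 < B /\ exists N, forall n, (N <= n)%N -> fnorm q (u n) <= B.
Proof.
move=> [Du cu]; have [N uN] := cu 1 ltr01.
exists (fnorm q (u N) + 1); split; first by rewrite ltr_wpDl ?fnorm_ge0.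
exists N => n nN; have := uN n N nN (leqnn N).
have := fnormD h (lin_subsetB linD (Du n) (Du N)) (Du N).
rewrite subrK; lra.
Qed.

Lemma fcauchy_comb a u v : fcauchy u -> fcauchy v ->
  fcauchy (fun n => a *: u n + v n).
Proof.
move=> [Du cu] [Dv cv]; split=> [n|e e0]; first exact: linD.2.
have a0 : 0 <= Re `|a| by rewrite ge0_Re.
pose e' := e / (2 * (Re `|a| + 1)).
have e'0 : 0 < e' by rewrite divr_gt0 // mulr_gt0 // ltr_wpDl.
have [N uN] := cu _ e'0; have [N' vN] := cv (e / 2) ltac:(lra).
exists (maxn N N') => m n; rewrite !geq_max => /andP[Nm N'm] /andP[Nn N'n].
rewrite opprD addrACA -scalerBr.
apply: (le_lt_trans (fnormD h _ _)).
- by apply: lin_subsetZ => //; apply: lin_subsetB.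
- exact: lin_subsetB.
rewrite (fnormZ h); last exact: lin_subsetB.
have h1 := uN _ _ Nm Nn; have h2 := vN _ _ N'm N'n.
have h3 : Re `|a| * fnorm q (u m - u n) <= Re `|a| * e'.
  by rewrite ler_wpM2l // ltW.
have h4 : Re `|a| * e' <= e / 2.
  rewrite /e' mulrA ler_pdivrMr ?mulr_gt0 ?ltr_wpDl //; lra.
lra.
Qed.

Lemma sdot_cvg u v : fcauchy u -> fcauchy v ->
  exists z : R[i]^o, (q (u n) (v n) : R[i]^o) @[n --> \oo] --> z.
Proof.
move=> cu cv; apply: cauchyn_cvgC => e e0.
have [B [B0 [Nb ub]]] := fcauchy_bd cu; have [C [C0 [Nc vc]]] := fcauchy_bd cv.
have [Du cu'] := cu; have [Dv cv'] := cv.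
have [N uN] := cu' (e / (2 * C)) (divr_gt0 e0 (mulr_gt0 (ltr0Sn _ 1) C0)).
have [N' vN] := cv' (e / (2 * B)) (divr_gt0 e0 (mulr_gt0 (ltr0Sn _ 1) B0)).
exists (maxn (maxn Nb Nc) (maxn N N')) => m n; rewrite !geq_max.
move=> /andP[/andP[mb mc] /andP[mN mN']] /andP[/andP[nb nc] /andP[nN nN']].
have -> : q (u m) (v m) - q (u n) (v n) =
    q (u m - u n) (v m) + q (u n) (v m - v n).
  by rewrite (sdotB h) // (sdotBr h) // addrA subrK.
apply: (le_lt_trans (rnD _ _)).
have h1 := fnorm_cs h (lin_subsetB linD (Du m) (Du n)) (Dv m).
have h2 := fnorm_cs h (Du n) (lin_subsetB linD (Dv m) (Dv n)).
have h3 : fnorm q (u m - u n) * fnorm q (v m) < e / 2.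
  apply: (@le_lt_trans _ _ (fnorm q (u m - u n) * C)).
    by rewrite ler_wpM2l ?fnorm_ge0 ?vc.
  by have := uN _ _ mN nN; rewrite ltr_pdivlMr ?mulr_gt0 //; lra.
have h4 : fnorm q (u n) * fnorm q (v m - v n) < e / 2.
  apply: (@le_lt_trans _ _ (B * fnorm q (v m - v n))).
    by rewrite ler_wpM2r ?fnorm_ge0 ?ub.
  by have := vN _ _ mN' nN'; rewrite ltr_pdivlMr ?mulr_gt0 //; lra.
lra.
Qed.

Lemma gen_near u v f : gen u f -> fcauchy v -> forall e : R, 0 < e ->
  exists N, forall n, (N <= n)%N -> rn (f (v n) - q (u n) (v n)) < e.
Proof.
move=> [[Du cu] uf _] cv e e0; have [C [C0 [Nc vc]]] := fcauchy_bd cv.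
have [Dv _] := cv.
have [N uN] := cu (e / (2 * C)) (divr_gt0 e0 (mulr_gt0 (ltr0Sn _ 1) C0)).
exists (maxn Nc N) => n; rewrite geq_max => /andP[nc nN].
apply: (@le_lt_trans _ _ (e / 2)); last by lra.
apply: cvg_rn_le (uf _ (Dv n)) _; exists N => k kN.
rewrite -(sdotB h) //; apply: (le_trans (fnorm_cs h _ (Dv n))).
  exact: lin_subsetB.
apply: (@le_trans _ _ (fnorm q (u k - u n) * C)).
  by rewrite ler_wpM2l ?fnorm_ge0 ?vc.
by have := uN _ _ kN nN; rewrite ltr_pdivlMr ?mulr_gt0 //; lra.
Qed.

(** Both sequences are asymptotic to [f (v n)], so the limit depends on the functional [f] alone;
    this makes the inner product below well defined. *)
Lemma gen_swap u u' v f (z : R[i]^o) : gen u f -> gen u' f -> fcauchy v ->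
  (q (u n) (v n) : R[i]^o) @[n --> \oo] --> z ->
  (q (u' n) (v n) : R[i]^o) @[n --> \oo] --> z.
Proof.
move=> uf u'f cv qz.
have /(cvg_rn_small (v := fun n => f (v n))) fz := qz.
have /fz {}fz := gen_near uf cv; apply: (cvg_rn_small fz) => e e0.
have [N uN] := gen_near u'f cv e0; exists N => n nN.
by rewrite rnB uN.
Qed.

Definition gens : {pred E -> R[i]^o} := [pred f | `[< exists u, gen u f >]].

Lemma gensP f : (f \in gens) <-> exists u, gen u f.
Proof. by rewrite unfold_in; split=> /asboolP. Qed.

Lemma gen0 : gen (fun=> 0) 0.
Proof.
have D0 := lin_subset0 linD.
split=> [|psi Dpsi|psi _ //].
  by split=> // e e0; exists 0%N => m n _ _; rewrite subrr (fnorm0 h).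
by rewrite (sdot0 h) //; apply: cvg_cst.
Qed.

Lemma gen_comb a u v f g : gen u f -> gen v g ->
  gen (fun n => a *: u n + v n) (a *: f + g).
Proof.
move=> [cu uf f0] [cv vg g0]; split=> [|psi Dpsi|psi nDpsi].
- exact: fcauchy_comb.
- have e n : q (a *: u n + v n) psi = a *: (q (u n) psi : R[i]^o) + q (v n) psi.
    by rewrite (sdot_linear h) //; [apply: cu.1|apply: cv.1].
  by rewrite (eq_cvg _ _ e); exact: (cvgn_comb (uf _ Dpsi) (vg _ Dpsi)).
- by rewrite !fctE f0 // g0 // addr0 scaler0.
Qed.

Lemma gens_submod : subsemimod_closed gens.
Proof.
split=> [|a f /gensP[u uf]]; last first.
  have := gen_comb a uf gen0; rewrite addr0 => af.
  by apply/gensP; exists (fun n => a *: u n + 0).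
split=> [|f g /gensP[u uf] /gensP[v vg]]; apply/gensP.
  by exists (fun=> 0); exact: gen0.
have := gen_comb 1 uf vg; rewrite scale1r => fg.
by exists (fun n => 1 *: u n + v n).
Qed.

HB.instance Definition _ := GRing.isSubmodClosed.Build R[i] (E -> R[i]^o) gens
  gens_submod.

(** Cauchy sequences whose difference tends to zero define the same functional, so no quotient is
    taken, and the vector space structure is that of a subspace of functions. *)
Record completion := Completion { cfun : E -> R[i]^o; _ : cfun \in gens }.

HB.instance Definition _ := [isSub for cfun].
HB.instance Definition _ := [Choice of completion by <:].
HB.instance Definition _ := [SubChoice_isSubLmodule of completion by <:].

Implicit Types F G : completion.

Lemma genE F : exists u, gen u (cfun F).
Proof. by case: F => f /=; rewrite gensP. Qed.

Definition rep F : nat -> E := projT1 (cid (genE F)).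

Lemma repP F : gen (rep F) (cfun F).
Proof. exact: projT2 (cid (genE F)). Qed.

Lemma gen_cauchy u f : gen u f -> fcauchy u.
Proof. by case. Qed.

Definition cdot F G : R[i] :=
  projT1 (cid (sdot_cvg (gen_cauchy (repP F)) (gen_cauchy (repP G)))).

Lemma cdot_sym_cvg u v (z : R[i]^o) : fcauchy u -> fcauchy v ->
  (q (u n) (v n) : R[i]^o) @[n --> \oo] --> z ->
  (q (v n) (u n) : R[i]^o) @[n --> \oo] --> (Num.conj z : R[i]^o).
Proof.
move=> [Du _] [Dv _] /cvg_conj qz.
have e n : (Num.conj (q (u n) (v n)) : R[i]^o) = q (v n) (u n).
  by rewrite [RHS](sdot_conj h).
by rewrite (eq_cvg _ _ e) in qz.
Qed.

(** The chosen representatives are exchanged one argument at a time, the second one after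
    conjugation. *)
Lemma cdotP u v F G : gen u (cfun F) -> gen v (cfun G) ->
  (q (u n) (v n) : R[i]^o) @[n --> \oo] --> (cdot F G : R[i]^o).
Proof.
move=> uF vG.
have cu := gen_cauchy uF; have cv := gen_cauchy vG.
have rF := repP F; have rG := repP G.
have cF := gen_cauchy rF; have cG := gen_cauchy rG.
have /(gen_swap rF uF cG) uG : (q (rep F n) (rep G n) : R[i]^o) @[n --> \oo] -->
  (cdot F G : R[i]^o) by rewrite /cdot; case: cid.
have := cdot_sym_cvg cu cG uG => /(gen_swap rG vG cu) vu.
by have := cdot_sym_cvg cv cu vu; rewrite conjCK.
Qed.

Lemma cdot_linear a F G K : cdot (a *: F + G) K = a * cdot F K + cdot G K.
Proof.
have [u uF] := genE F; have [v vG] := genE G; have [w wK] := genE K.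
have uv : gen (fun n => a *: u n + v n) (cfun (a *: F + G)).
  exact: (gen_comb a uF vG).
apply: (cvgn_unique (cdotP uv wK)).
have e n : q (a *: u n + v n) (w n) =
    a *: (q (u n) (w n) : R[i]^o) + q (v n) (w n).
  by rewrite (sdot_linear h) //;
    case: uF vG wK => [[? ?] ? ?] [[? ?] ? ?] [[? ?] ? ?].
by rewrite (eq_cvg _ _ e); exact: (cvgn_comb (cdotP uF wK) (cdotP vG wK)).
Qed.

Lemma cdot_conj F G : cdot F G = Num.conj (cdot G F).
Proof.
have [u uF] := genE F; have [v vG] := genE G.
apply: (cvgn_unique (cdotP uF vG)).
exact: cdot_sym_cvg (gen_cauchy vG) (gen_cauchy uF) (cdotP vG uF).
Qed.

Lemma cdot_ge0 F : 0 <= cdot F F.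
Proof.
have [u uF] := genE F; apply: cvg_ge0 (cdotP uF uF) => n.
by rewrite (sdot_ge0 h) //; case: uF => [[? ?] ? ?].
Qed.

(** By Cauchy-Schwarz against each [psi], a null sequence generates the zero functional. *)
Lemma cdot_eq0 F : cdot F F = 0 -> F = 0.
Proof.
move=> F0; have [u uF] := genE F; have := cdotP uF uF; rewrite F0 => u0.
have [[Du _] uf f0] := uF.
apply: val_inj; apply/funext => psi /=.
have [Dpsi|nDpsi] := pselect (D psi); last exact: f0.
apply: (cvgn_unique (uf _ Dpsi)); apply/cvgnP => e e0.
have p0 := fnorm_ge0 q psi.
have e'0 : 0 < e / (fnorm q psi + 1) by rewrite divr_gt0 // ltr_wpDl.
have [N uN] := (cvgnP _ _).1 u0 _ (exprn_gt0 2 e'0).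
exists N => n nN; rewrite subr0; apply: (le_lt_trans (fnorm_cs h (Du n) Dpsi)).
have : fnorm q (u n) < e / (fnorm q psi + 1).
  rewrite (fnorm_lt h) //; apply: le_lt_trans (uN _ nN); rewrite subr0.
  exact: le_trans (ler_norm _) (Re_le_rn _).
rewrite ltr_pdivlMr ?ltr_wpDl // => h1.
apply: le_lt_trans h1; rewrite ler_wpM2l ?fnorm_ge0 //; lra.
Qed.

Lemma cdot_semi : semi_dot [set: completion] cdot.
Proof.
split=> // [a u v w _ _ _|u v _ _|u _].
- exact: cdot_linear.
- exact: cdot_conj.
- exact: cdot_ge0.
Qed.

(** Zero as soon as one argument is off [D]: then every [phi], in [D] or not, gives an element of
    [gens], and [embed] is total. *)
Definition embed_fun (phi : E) : E -> R[i]^o :=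
  fun psi => if `[< D phi /\ D psi >] then q phi psi else 0.

Lemma embed_gen phi : D phi -> gen (fun=> phi) (embed_fun phi).
Proof.
move=> Dphi; split=> [|psi Dpsi|psi nDpsi].
- split=> // e e0; exists 0%N => m n _ _.
  by rewrite subrr (fnorm0 h).
- rewrite /embed_fun; case: asboolP => [_|[]]; last by split.
  exact: cvg_cst.
- by rewrite /embed_fun; case: asboolP => // -[].
Qed.

Lemma embed_gens phi : embed_fun phi \in gens.
Proof.
apply/gensP; have [Dphi|nDphi] := pselect (D phi).
  by exists (fun=> phi); exact: embed_gen.
rewrite (_ : embed_fun phi = 0); first by exists (fun=> 0); exact: gen0.
by apply/funext => psi; rewrite /embed_fun; case: asboolP => // -[].
Qed.

Definition embed phi : completion := Completion (embed_gens phi).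

Lemma embed_dot phi psi : D phi -> D psi ->
  cdot (embed phi) (embed psi) = q phi psi.
Proof.
move=> Dphi Dpsi; have := cdotP (F := embed phi) (G := embed psi)
  (embed_gen Dphi) (embed_gen Dpsi).
by move/cvgn_unique; apply; exact: cvg_cst.
Qed.

Lemma embed_comb a phi psi : D phi -> D psi ->
  embed (a *: phi + psi) = a *: embed phi + embed psi.
Proof.
move=> Dphi Dpsi; apply: val_inj; apply/funext => x /=.
rewrite !fctE /embed_fun.
have Dc : D (a *: phi + psi) by apply: linD.2.
have [Dx|nDx] := pselect (D x).
  rewrite !ifT; [exact: (sdot_linear h)|exact/asboolP..].
rewrite !ifF ?scaler0 ?addr0 //; by apply/asboolP => -[].
Qed.

Lemma embed_dense u F : gen u (cfun F) -> forall e : R, 0 < e ->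
  exists N, forall n, (N <= n)%N -> fnorm cdot (F - embed (u n)) < e.
Proof.
move=> uF e e0; have [[Du cu] _ _] := uF.
have [N uN] := cu (e / 2) (divr_gt0 e0 (ltr0Sn _ 1)); exists N => n nN.
(* The element [F - embed (u n)] is generated by [u k - u n] with [k] running, so its squared norm
   is the limit of those of [u k - u n] for [q]. *)
have gn : gen (fun k => (-1) *: u n + u k) (cfun (F - embed (u n))).
  have -> : cfun (F - embed (u n)) = (-1) *: embed_fun (u n) + cfun F.
    by rewrite scaleN1r addrC.
  exact: gen_comb (embed_gen (Du n)) uF.
rewrite (fnorm_lt cdot_semi) //.
have /cvg_Re qz := cdotP gn gn.
apply: (@le_lt_trans _ _ ((e / 2) ^+ 2)); last by nra.
apply: (cvg_real_le qz); exists N => k kN.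
rewrite -(sqr_fnorm h); last by apply: linD.2.
rewrite ler_pXn2r ?nnegrE ?fnorm_ge0 //; last lra.
by rewrite ltW // scaleN1r addrC uN.
Qed.

(** Replace [x n] by an element [w n] of [D] within [1 / (n + 1)]; the sequence [w] is Cauchy for
    [q], and the functional it generates is the limit. *)
Lemma cdot_complete (x : nat -> completion) :
  (forall e : R, 0 < e -> exists N, forall m n, (N <= m)%N -> (N <= n)%N ->
     Re (cdot (x m - x n) (x m - x n)) < e) ->
  exists y, forall e : R, 0 < e -> exists N, forall n, (N <= n)%N ->
     Re (cdot (x n - y) (x n - y)) < e.
Proof.
move=> cx.
have /choice[w wx] (n : nat) : exists w, D w /\
    fnorm cdot (x n - embed w) < n.+1%:R^-1.
  have [u uF] := genE (x n).
  have [N uN] := embed_dense uF (e := n.+1%:R^-1) ltac:(by rewrite invr_gt0).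
  by exists (u N); split; [case: uF => [[]]|exact: uN].
have Dw n : D (w n) by case: (wx n).
have sd := cdot_semi.
have embedB m n : fnorm cdot (embed (w m) - embed (w n)) = fnorm q (w m - w n).
  have -> : embed (w m) - embed (w n) = embed (w m - w n).
    by rewrite addrC -(scaleN1r (embed _)) -embed_comb // scaleN1r addrC.
  by rewrite /fnorm embed_dot //; exact: lin_subsetB.
have cw : fcauchy w.
  split=> // e e0.
  have e3 : 0 < e / 3 by rewrite divr_gt0.
  have [N1 h1] := invSn_lt e3; have [N2 h2] := cx _ (exprn_gt0 2 e3).
  exists (maxn N1 N2) => m n; rewrite !geq_max => /andP[m1 m2] /andP[n1 n2].
  rewrite -embedB.
  have t1 := @fnorm_triangle _ _ _ _ sd (embed (w m)) (x m) (embed (w n)) I I I.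
  have t2 := @fnorm_triangle _ _ _ _ sd (x m) (x n) (embed (w n)) I I I.
  have := h2 _ _ m2 n2; rewrite -(fnorm_lt sd) // => h3.
  have [_ h4] := wx m; have [_ h5] := wx n.
  rewrite (@fnormB _ _ _ _ sd (embed _) (x m)) // in t1.
  apply: (le_lt_trans t1).
  rewrite (_ : e = e / 3 + (e / 3 + e / 3)); last by field.
  apply: ltrD; first exact: lt_trans h4 (h1 _ m1).
  by apply: (le_lt_trans t2); apply: ltrD => //; exact: lt_trans h5 (h1 _ n1).
have /choice[f fP] (psi : E) : exists z : R[i]^o,
    (D psi -> (q (w n) psi : R[i]^o) @[n --> \oo] --> z) /\ (~ D psi -> z = 0).
  have [Dpsi|nDpsi] := pselect (D psi); last by exists 0.
  have [z qz] := sdot_cvg cw (gen_cauchy (embed_gen Dpsi)).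
  by exists z.
have wf : gen w f by split=> // psi; [apply: (fP psi).1|apply: (fP psi).2].
have fg : f \in gens by apply/gensP; exists w.
exists (Completion fg) => e e0.
have s0 : 0 < Num.sqrt e / 2 by rewrite divr_gt0 // sqrtr_gt0.
have [N1 h1] := invSn_lt s0.
have [N2 h2] := embed_dense (F := Completion fg) wf s0.
exists (maxn N1 N2) => n; rewrite !geq_max => /andP[n1 n2].
rewrite -(sqr_sqrtr (ltW e0)) -(fnorm_lt sd) ?sqrtr_gt0 //.
have t1 := @fnorm_triangle _ _ _ _ sd (x n) (embed (w n)) (Completion fg) I I I.
apply: (le_lt_trans t1); rewrite [X in _ < X]splitr ltrD //.
  exact: lt_trans (wx n).2 (h1 _ n1).
by rewrite (fnormB sd) ?h2.
Qed.

Lemma cdot_complete_dot : complete_dot cdot.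
Proof.
split=> [||F F0|]; [exact: cdot_linear|exact: cdot_conj| |exact: cdot_complete].
rewrite lt_def cdot_ge0 andbT; apply/eqP => /cdot_eq0 F0'.
by rewrite F0' eqxx in F0.
Qed.

(** Serves two purposes: to factor a given semibounded form through an operator, and to produce the
    operator of a limit of forms. *)
Theorem hilbert_completion : exists (K : hilbertType R) (j : E -> K),
  (forall a (u v : E), D u -> D v -> j (a *: u + v) = a *: j u + j v) /\
  forall (u v : E), D u -> D v -> '[j u, j v] = q u v.
Proof.
exists (dot_space cdot_complete_dot), embed; split; first exact: embed_comb.
exact: embed_dot.
Qed.

End Completion.

(** * Operators and the variational problem *)

Section HilbertBasics.
Variables (R : realType) (V : hilbertType R).
Implicit Types x y z : V.

Lemma dotDl x y z : '[x + y, z] = '[x, z] + '[y, z].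
Proof. exact: linearDl. Qed.
Lemma dotDr x y z : '[z, x + y] = '[z, x] + '[z, y].
Proof. exact: linearDr. Qed.
Lemma dotNl x z : '[- x, z] = - '[x, z].
Proof. exact: linearNl. Qed.
Lemma dotNr x z : '[z, - x] = - '[z, x].
Proof. exact: linearNr. Qed.
Lemma dotBl x y z : '[x - y, z] = '[x, z] - '[y, z].
Proof. exact: linearBl. Qed.
Lemma dotBr x y z : '[z, x - y] = '[z, x] - '[z, y].
Proof. exact: linearBr. Qed.
Lemma dotZl a x z : '[a *: x, z] = a * '[x, z].
Proof. exact: linearZl_LR. Qed.
Lemma dotZr a x z : '[z, a *: x] = Num.conj a * '[z, x].
Proof. exact: linearZr_LR. Qed.
Lemma dot0l z : '[0, z] = 0 :> R[i].
Proof. exact: linear0l. Qed.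
Lemma dot0r z : '[z, 0] = 0 :> R[i].
Proof. exact: linear0r. Qed.
Lemma dotC x y : '[x, y] = Num.conj '[y, x].
Proof. by have := hermC hdot x y; rewrite expr0 mul1r. Qed.

Lemma dotE x : '[x, x] = (rn x ^+ 2)%:C.
Proof. by rewrite hdotxx rnE rmorphXn. Qed.

Lemma Re_dotE x : Re '[x, x] = rn x ^+ 2.
Proof. by rewrite dotE. Qed.

Lemma dot_semi : semi_dot [set: V] (fun x y => '[x, y]).
Proof.
split=> [|a u v w _ _ _|u v _ _|u _].
- by [].
- by rewrite dotDl dotZl.
- exact: dotC.
- by rewrite dotE ler0c sqr_ge0.
Qed.

Lemma fnorm_dot x : fnorm (fun x y : V => '[x, y]) x = rn x.
Proof. by rewrite /fnorm Re_dotE sqrtr_sqr ger0_norm // rn_ge0. Qed.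

Lemma dot_cs x y : rn ('[x, y] : R[i]^o) <= rn x * rn y.
Proof. by rewrite -!fnorm_dot (fnorm_cs dot_semi). Qed.

Lemma cvg_dot (u v : nat -> V) x y : u n @[n --> \oo] --> x ->
  v n @[n --> \oo] --> y ->
  ('[u n, v n] : R[i]^o) @[n --> \oo] --> ('[x, y] : R[i]^o).
Proof.
move=> ux vy; have vb := cvg_rn vy.
have wv : ('[x, v n] : R[i]^o) @[n --> \oo] --> ('[x, y] : R[i]^o).
  apply/cvgnP => e e0; have x0 := rn_ge0 x.
  have e'0 : 0 < e / (rn x + 1) by rewrite divr_gt0 // ltr_wpDl.
  have [N vN] := (cvgnP v y).1 vy _ e'0; exists N => n nN.
  rewrite -dotBr; apply: (le_lt_trans (dot_cs _ _)).
  have := vN _ nN; rewrite ltr_pdivlMr ?ltr_wpDl // => h1.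
  apply: le_lt_trans h1; rewrite mulrC ler_wpM2l ?rn_ge0 //; lra.
apply: (cvg_rn_small wv) => e e0.
have y0 := rn_ge0 y.
have e'0 : 0 < e / (rn y + 1) by rewrite divr_gt0 // ltr_wpDl.
have [N uN] := (cvgnP u x).1 ux _ e'0.
have [N' vN] := (cvgnP v y).1 vy 1 ltr01.
exists (maxn N N') => n; rewrite geq_max => /andP[nN nN'].
rewrite -dotBl; apply: (le_lt_trans (dot_cs _ _)).
have := uN _ nN; rewrite ltr_pdivlMr ?ltr_wpDl // => h1.
apply: le_lt_trans h1; rewrite ler_wpM2l ?rn_ge0 //.
have := rnD (v n - y) y; rewrite subrK; have := vN _ nN'; lra.
Qed.

Lemma rn_sqr_comb (a : R[i]) x y : rn (x + a *: y) ^+ 2 =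
  rn x ^+ 2 + 2 * Re (Num.conj a * '[x, y]) + rn (a : R[i]^o) ^+ 2 * rn y ^+ 2.
Proof.
rewrite -Re_dotE dotDl !dotDr dotZr dotZl !ReD Re_dotE.
have -> : Re (a * '[y, x]) = Re (Num.conj a * '[x, y]).
  by rewrite -[LHS]Re_conjc rmorphM /= -dotC.
have -> : Re '[a *: y, a *: y] = rn (a : R[i]^o) ^+ 2 * rn y ^+ 2.
  by rewrite Re_dotE rnZ exprMn.
lra.
Qed.

Lemma parallelogram x y :
  rn (x + y) ^+ 2 + rn (x - y) ^+ 2 = 2 * rn x ^+ 2 + 2 * rn y ^+ 2.
Proof.
rewrite -!Re_dotE !(dotDl, dotDr, dotNl, dotNr) !(ReD, ReN); lra.
Qed.

End HilbertBasics.

Section Operator.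
Variables (R : realType) (H K : hilbertType R) (Q : operator H K).
Hypothesis linQ : linear_op Q.

Let linD := linQ.1.

Lemma op_comb a u v : odom Q u -> odom Q v -> Q (a *: u + v) = a *: Q u + Q v.
Proof. exact: linQ.2. Qed.

Lemma opD u v : odom Q u -> odom Q v -> Q (u + v) = Q u + Q v.
Proof. by move=> Qu Qv; rewrite -{1}(scale1r u) op_comb // scale1r. Qed.

Lemma op0 : Q 0 = 0.
Proof.
have D0 := lin_subset0 linD.
by apply: (addrI (Q 0)); rewrite -opD // !addr0.
Qed.

Lemma opZ a u : odom Q u -> Q (a *: u) = a *: Q u.
Proof.
move=> Qu; have := op_comb a Qu (lin_subset0 linD).
by rewrite op0 !addr0.
Qed.

Lemma opB u v : odom Q u -> odom Q v -> Q (u - v) = Q u - Q v.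
Proof.
by move=> Qu Qv; rewrite addrC -scaleN1r op_comb // scaleN1r addrC.
Qed.

Lemma closure_graphP x y : closure (graph Q) (x, y) <->
  exists u : nat -> H, [/\ forall n, odom Q (u n), u n @[n --> \oo] --> x
    & Q (u n) @[n --> \oo] --> y].
Proof.
split=> [cxy|[u [Du ux Qu]] B Bxy]; last first.
  have : (u n, Q (u n)) @[n --> \oo] --> (x, y) by apply: cvg_pair.
  move=> /(_ B Bxy) [N _ NB]; exists (u N, Q (u N)); split; first by split=> /=.
  exact: (NB N (leqnn N)).
have /choice[u uP] (n : nat) : exists u, [/\ odom Q u, rn (u - x) < n.+1%:R^-1
    & rn (Q u - y) < n.+1%:R^-1].
  have e0 : (0 : R[i]) < (n.+1%:R^-1)%:C by rewrite ltcR invr_gt0.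
  have [|[u z] [[/= Du ->] [/=]]] := cxy (ball (x, y) (n.+1%:R^-1)%:C).
    exact: nbhsx_ballx.
  rewrite -!ball_normE /= !rnE !ltcR => h1 h2.
  by exists u; rewrite rnB [rn (Q u - y)]rnB.
have small (V : hilbertType R) (v : nat -> V) (z : V) :
    (forall n, rn (v n - z) < n.+1%:R^-1) -> v n @[n --> \oo] --> z.
  move=> vz; apply/cvgnP => e e0.
  have [N _ Nh] := near_infty_natSinv_lt (PosNum e0).
  by exists N => n nN; apply: lt_trans (vz n) (Nh n nN).
exists u; split=> [n||]; first by case: (uP n).
- by apply: small => n; case: (uP n).
- by apply: small => n; case: (uP n).
Qed.

(* The minimum of |f - psi|^2 + |Q psi|^2 over the domain, attained in the
   closure of the graph; the last clause is its Euler-Lagrange equation. *)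
Lemma form_minimizer (f : H) : exists (phi : H) (y : K),
  closure (graph Q) (phi, y) /\
  forall psi, odom Q psi -> '[phi, psi] + '[y, Q psi] = '[f, psi].
Proof.
pose F psi : R := rn (f - psi) ^+ 2 + rn (Q psi) ^+ 2.
pose S := [set F psi | psi in odom Q].
have S0 : S !=set0 by exists (F 0); exists 0 => //; exact: lin_subset0 linD.
have S_lb : has_lbound S.
  by exists 0 => _ [psi _ <-]; rewrite addr_ge0 ?sqr_ge0.
have d_le psi : odom Q psi -> inf S <= F psi.
  by move=> Dpsi; apply: ge_inf => //; exists psi.
set d := inf S in d_le.
have /choice[u uP] (n : nat) : exists u, odom Q u /\ F u < d + n.+1%:R^-1.
  have e0 : 0 < n.+1%:R^-1 :> R by rewrite invr_gt0.
  by have [_ [u Du <-] Fu] := inf_adherent e0 (conj S0 S_lb); exists u.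
have Du n := (uP n).1.
(* Parallelogram law for both components: the midpoint lies in the domain, where [F] is at least
   [d], so values [F (u m)] and [F (u n)] near [d] force the points together in the graph norm. *)
have dist m n : rn (u m - u n) ^+ 2 + rn (Q (u m) - Q (u n)) ^+ 2 <=
    2 * m.+1%:R^-1 + 2 * n.+1%:R^-1.
  have Dmn := lin_subsetD linD (Du m) (Du n).
  have Dh := lin_subsetZ linD 2^-1 Dmn.
  have := d_le _ Dh; rewrite /F.
  have := (uP m).2; have := (uP n).2; rewrite /F.
  have := parallelogram (f - u m) (f - u n).
  have := parallelogram (Q (u m)) (Q (u n)).
  have -> : f - u m - (f - u n) = u n - u m by rewrite opprB addrC addrA subrK.
  have -> : f - u m + (f - u n) = 2%:R *: (f - 2^-1 *: (u m + u n)).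
    rewrite scalerBr scalerA divff // scale1r scaler_nat mulr2n.
    by rewrite addrACA -opprD.
  have -> : Q (u m) + Q (u n) = 2%:R *: Q (2^-1 *: (u m + u n)).
    by rewrite opZ // scalerA divff // scale1r opD.
  rewrite !rnZ (_ : rn (2%:R : R[i]^o) = 2); last by rewrite /rn normr_nat.
  rewrite (rnB (u n)) !exprMn.
  move: (m.+1%:R^-1) (n.+1%:R^-1) => p r; lra.
have cau (V : hilbertType R) (v : nat -> V) : (forall m n,
    rn (v m - v n) ^+ 2 <= 2 * m.+1%:R^-1 + 2 * n.+1%:R^-1) ->
    exists x : V, v n @[n --> \oo] --> x.
  move=> vb; apply: cauchyn_cvg => e e0.
  have [N hN] := invSn_lt (divr_gt0 (exprn_gt0 2 e0) (ltr0Sn _ 3)).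
  exists N => m n Nm Nn.
  rewrite -(@ltr_pXn2r _ 2) ?nnegrE ?rn_ge0 ?(ltW e0) //.
  apply: (le_lt_trans (vb m n)); have := hN _ Nm; have := hN _ Nn.
  move: (m.+1%:R^-1) (n.+1%:R^-1) => p r; lra.
have [phi uphi] : exists x : H, u n @[n --> \oo] --> x.
  apply: cau => m n; apply: le_trans (dist m n); rewrite lerDl sqr_ge0 //.
have [y Qy] : exists x : K, Q (u n) @[n --> \oo] --> x.
  apply: (cau _ (fun n => Q (u n))) => m n; apply: le_trans (dist m n).
  by rewrite lerDr sqr_ge0.
exists phi, y; split; first by apply/closure_graphP; exists u.
move=> psi Dpsi.
(* The limit [phi] need not belong to the domain of [Q]; with [y] in the place of [Q phi] the
   functional is still a limit of values on the domain. *)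
have Fcvg (a : R[i]) : rn (f - (u n + a *: psi)) ^+ 2 +
    rn (Q (u n) + a *: Q psi) ^+ 2 @[n --> \oo] -->
    rn (f - (phi + a *: psi)) ^+ 2 + rn (y + a *: Q psi) ^+ 2.
  have sq (b : nat -> R) (l : R) : b n @[n --> \oo] --> l ->
      b n ^+ 2 @[n --> \oo] --> l ^+ 2.
    by move=> bl; exact: (@cvgM _ _ _ _ b b l l bl bl).
  have aff (V : hilbertType R) (v : nat -> V) (x w : V) :
      v n @[n --> \oo] --> x -> v n + w @[n --> \oo] --> x + w.
    by move=> vx; apply: cvgD vx _; exact: cvg_cst.
  have c1 : f - (u n + a *: psi) @[n --> \oo] --> f - (phi + a *: psi).
    by apply: cvgn_sub; [exact: cvg_cst|exact: aff].
  have c2 : Q (u n) + a *: Q psi @[n --> \oo] --> y + a *: Q psi.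
    exact: (aff _ (fun n => Q (u n))).
  exact: cvgD (sq _ _ (cvg_rn c1)) (sq _ _ (cvg_rn c2)).
have low (a : R[i]) : d <=
    rn (f - (phi + a *: psi)) ^+ 2 + rn (y + a *: Q psi) ^+ 2.
  rewrite -lerN2; apply: (cvg_real_le (cvgN (Fcvg a))); exists 0%N => n _.
  have Dn : odom Q (u n + a *: psi).
    by apply: lin_subsetD => //; exact: lin_subsetZ.
  rewrite lerN2; apply: (le_trans (d_le _ Dn)).
  by rewrite /F opD ?opZ //; exact: lin_subsetZ.
have eqd : rn (f - phi) ^+ 2 + rn y ^+ 2 <= d.
  have := Fcvg 0; rewrite !scale0r !addr0 => F0.
  apply/ler_addgt0Pr => e e0; apply: (cvg_real_le F0).
  have [N hN] := invSn_lt e0; exists N => n nN.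
  have := (uP n).2; have := hN _ nN; rewrite /F !addr0.
  move: (n.+1%:R^-1) => p h1 h2; apply: (le_trans (ltW h2)).
  by rewrite lerD2l ltW.
set x := f - phi in eqd.
(* Up to a constant factor, [z] is the first variation in the direction [psi]. *)
pose z : R[i]^o := '[x, psi] - '[y, Q psi].
suff : z = 0.
  move/eqP; rewrite subr_eq0 /x dotBl => /eqP <-.
  by rewrite addrC subrK.
pose N := rn psi ^+ 2 + rn (Q psi) ^+ 2.
have N0 : 0 <= N by rewrite addr_ge0 ?sqr_ge0.
(* Moving by [s z psi] changes the functional by [|z|^2 (s^2 N - 2 s)], which is negative for
   [s N <= 1] unless [z = 0]; the summand 1 covers [N = 0]. *)
pose s : R := (N + 1)^-1.
have s0 : 0 < s by rewrite invr_gt0 ltr_wpDl.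
have sN : s * (N + 1) = 1 by rewrite mulVf // gt_eqF // ltr_wpDl.
have := low (s%:C * z).
rewrite opprD addrA -/x -scaleNr !rn_sqr_comb.
have -> : rn (- (s%:C * z) : R[i]^o) = s * rn z.
  by rewrite rnN rnM rn_real gtr0_norm.
have -> : rn (s%:C * z : R[i]^o) = s * rn z.
  by rewrite rnM rn_real gtr0_norm.
have -> : Re (Num.conj (- (s%:C * z)) * '[x, psi]) =
    - (s * Re (Num.conj z * '[x, psi])).
  by rewrite rmorphN mulNr ReN Re_conjZ.
rewrite Re_conjZ.
have zz : Re (Num.conj z * '[x, psi]) - Re (Num.conj z * '[y, Q psi]) =
    rn z ^+ 2.
  rewrite -ReB -mulrBr -/z Re_mulconj [`|_|](rnE z).
  by rewrite -(rmorphXn (real_complex R)).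
move=> hl; apply: rn_eq0; apply/eqP; rewrite -sqrf_eq0; apply/eqP.
have hz : 2 * s * rn z ^+ 2 <= s * (s * N) * rn z ^+ 2.
  have -> : 2 * s * rn z ^+ 2 = 2 * (s * Re (Num.conj z * '[x, psi])) -
      2 * (s * Re (Num.conj z * '[y, Q psi])) by rewrite -zz; ring.
  move: hl eqd; rewrite /N.
  move: (Re _) (Re _) (rn x) (rn y) (rn z) (rn psi) (rn (Q psi)).
  move=> A B p q r t v.
  lra.
have sN1 : s * N <= 1 by lra.
have r0 := sqr_ge0 (rn z).
have h1 : s * (s * N) * rn z ^+ 2 <= s * 1 * rn z ^+ 2.
  by rewrite ler_wpM2r // ler_wpM2l // ltW.
apply/eqP; rewrite eq_le r0 andbT -(pmulr_rle0 _ s0).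
move: hz h1; move: (rn z ^+ 2) => r; lra.
Qed.

End Operator.

Lemma closedn_cvg (T : topologicalType) (A : set T) (u : nat -> T) x :
  closed A -> (forall n, A (u n)) -> u n @[n --> \oo] --> x -> A x.
Proof.
move=> cA Au ux; apply: (@closed_cvg _ _ \oo _ u A) ux => //.
exact: nearW.
Qed.

(** * Orthogonal projections onto closed subspaces *)

Section OrthogonalProjection.
Variables (R : realType) (K : hilbertType R) (M : set K).
Hypotheses (linM : linear_subset M) (clM : closed M).
Implicit Types x y z : K.

Lemma orthproj_exists x : exists y, M y /\ forall z, M z -> '[x - y, z] = 0.
Proof.
(* For the zero operator on [M] the Euler-Lagrange equation says that [x - y] is orthogonal to
   [M]. *)
pose Z : operator K K := Operator M (fun=> 0).
have linZ : linear_op Z by split=> // a u v _ _ /=; rewrite scaler0 addr0.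
have [y [w [cyw yP]]] := form_minimizer linZ x.
have [u [Mu uy _]] := (closure_graphP Z y w).1 cyw.
exists y; split; first exact: closedn_cvg clM Mu uy.
by move=> z Mz; rewrite dotBl -(yP z Mz) /= dot0r addr0 subrr.
Qed.

Lemma orthprojP x :
  M (orthproj M x) /\ forall z, M z -> '[x - orthproj M x, z] = 0.
Proof.
have [y yP] := orthproj_exists x.
exact: (xgetPex 0 (ex_intro (fun y => M y /\ _) y yP)).
Qed.

Lemma orthproj_in x : M (orthproj M x).
Proof. by case: (orthprojP x). Qed.

Lemma orthproj_orth x z : M z -> '[x - orthproj M x, z] = 0.
Proof. by case: (orthprojP x) => _; apply. Qed.

Lemma orthproj_eq x y : M y -> (forall z, M z -> '[x - y, z] = 0) ->
  orthproj M x = y.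
Proof.
move=> My yP; have [Mp pP] := orthprojP x.
apply/eqP; rewrite -subr_eq0; apply/eqP/rn_eq0/eqP; rewrite -sqrf_eq0.
have Md := lin_subsetB linM Mp My.
rewrite -Re_dotE -[X in '[X, _]](_ : (x - y) - (x - orthproj M x) = _).
  by rewrite dotBl yP // pP // subrr.
by rewrite opprB addrC addrA subrK.
Qed.

Lemma orthproj_comb a x y :
  orthproj M (a *: x + y) = a *: orthproj M x + orthproj M y.
Proof.
have [Mx xP] := orthprojP x; have [My yP] := orthprojP y.
apply: orthproj_eq; first exact: linM.2.
move=> z Mz; rewrite opprD addrACA -scalerBr dotDl dotZl xP // yP //.
by rewrite mulr0 addr0.
Qed.

Lemma orthproj0 x : (forall z, M z -> '[x, z] = 0) -> orthproj M x = 0.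
Proof.
by move=> x0; apply: orthproj_eq => [|z]; [case: linM|rewrite subr0; exact: x0].
Qed.

Lemma orthproj_best x z : M z -> rn (x - orthproj M x) <= rn (x - z).
Proof.
move=> Mz; have [Mx xP] := orthprojP x.
rewrite -(@ler_pXn2r _ 2) ?nnegrE ?rn_ge0 //.
have -> : x - z = x - orthproj M x + 1 *: (orthproj M x - z).
  by rewrite scale1r addrA subrK.
rewrite [X in _ <= X]rn_sqr_comb xP; last exact: lin_subsetB.
by rewrite mulr0 mulr0 addr0 lerDl mulr_ge0 ?sqr_ge0.
Qed.

Lemma orthproj_contract x : rn (x - orthproj M x) <= rn x.
Proof.
by have := orthproj_best x (lin_subset0 linM); rewrite subr0.
Qed.

End OrthogonalProjection.

(** * The closure of the graph and the regular part *)

Section ClosureGraph.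
Variables (R : realType) (H K : hilbertType R) (Q : operator H K).
Hypothesis linQ : linear_op Q.
Let linD := linQ.1.

Lemma closure_graph_comb a x y x' y' :
  closure (graph Q) (x, y) -> closure (graph Q) (x', y') ->
  closure (graph Q) (a *: x + x', a *: y + y').
Proof.
move=> /closure_graphP[u [Du ux Qu]] /closure_graphP[v [Dv vx Qv]].
apply/closure_graphP; exists (fun n => a *: u n + v n); split.
- by move=> n; apply: linD.2.
- exact: (cvgn_comb ux vx).
- have e n : Q (a *: u n + v n) = a *: Q (u n) + Q (v n) by rewrite op_comb.
  by rewrite (eq_cvg _ _ e); exact: (cvgn_comb Qu Qv).
Qed.

Lemma graph_closure u : odom Q u -> closure (graph Q) (u, Q u).
Proof. by move=> Du; apply: subset_closure; split. Qed.

Lemma closure_graph0 : closure (graph Q) (0, 0).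
Proof.
have := graph_closure (lin_subset0 linD); by rewrite op0.
Qed.

Lemma closure_graphB x y x' y' :
  closure (graph Q) (x, y) -> closure (graph Q) (x', y') ->
  closure (graph Q) (x - x', y - y').
Proof.
move=> c1 c2; rewrite (addrC x) (addrC y) -(scaleN1r x') -(scaleN1r y').
exact: closure_graph_comb.
Qed.

Lemma mul_linear : linear_subset (mul (closure (graph Q))).
Proof.
split=> [|a u v mu mv]; first exact: closure_graph0.
have := closure_graph_comb (a := a) mu mv; by rewrite scaler0 addr0.
Qed.

Lemma mul_closed : closed (mul (closure (graph Q))).
Proof.
apply: (@preimage_closed _ _ (fun y : K => (0 : H, y)));
  last exact: closed_closure.
by move=> y _; apply: cvg_pair => //; exact: cvg_cst.
Qed.

Local Notation N := (mul (closure (graph Q))).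

Lemma reg_linear : linear_op (reg_op Q).
Proof.
split=> // a u v Du Dv /=; rewrite op_comb //.
rewrite (orthproj_comb mul_linear mul_closed).
by rewrite opprD addrACA -scalerBr.
Qed.

Lemma reg_orth phi z : N z -> '[reg_op Q phi, z] = 0.
Proof. exact: (orthproj_orth mul_linear mul_closed). Qed.

(** The description of the closed regular part from which its closability and the invariance of the
    selfadjoint relation both follow. *)
Lemma closure_reg_graph x w : closure (graph (reg_op Q)) (x, w) <->
  closure (graph Q) (x, w) /\ forall z, N z -> '[w, z] = 0.
Proof.
split=> [/closure_graphP[u [Du ux Qu]]|[/closure_graphP[u [Du ux Qu]] w0]].
  split; last first.
    move=> z Nz; have := cvg_dot Qu (cvgn_cst z).
    have e n : '[reg_op Q (u n), z] = 0 by apply: reg_orth.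
    by rewrite (eq_cvg _ _ e) => /cvgn_unique; apply; exact: cvg_cst.
  (* The singular part of [Q (u n)] is approximated by [Q (v n)] with [v n]
     tending to 0. *)
  have /choice[v vP] (n : nat) : exists v, [/\ odom Q v,
      rn (v - 0) < n.+1%:R^-1 & rn (Q v - orthproj N (Q (u n))) < n.+1%:R^-1].
    have := orthproj_in mul_linear mul_closed (Q (u n)).
    move=> /closure_graphP[v [Dv v0 Qv]].
    have e0 : 0 < n.+1%:R^-1 :> R by rewrite invr_gt0.
    have [N1 h1] := (cvgnP _ _).1 v0 _ e0.
    have [N2 h2] := (cvgnP _ _).1 Qv _ e0.
    exists (v (maxn N1 N2)).
    by split; [exact: Dv|apply: h1; exact: leq_maxl|apply: h2; exact: leq_maxr].
  have small (V : hilbertType R) (a b : nat -> V) (z : V) :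
      a n @[n --> \oo] --> z -> (forall n, rn (b n - a n) < n.+1%:R^-1) ->
      b n @[n --> \oo] --> z.
    move=> az ab; apply: (cvg_rn_small az) => e e0.
    have [M _ Mh] := near_infty_natSinv_lt (PosNum e0).
    by exists M => n nM; apply: lt_trans (ab n) (Mh n nM).
  apply/closure_graphP; exists (fun n => u n - v n); split.
  - by move=> n; apply: (lin_subsetB linD); [exact: Du|case: (vP n)].
  - apply: (small _ _ _ _ ux) => n; have [_ + _] := vP n.
    by rewrite subr0 addrC addKr rnN.
  - apply: (small _ _ _ _ Qu) => n; have [Dv _ hv] := vP n.
    by rewrite (opB linQ (Du n) Dv) /= opprB addrC addrA subrK rnB.
apply/closure_graphP; exists u; split=> //.
apply/cvgnP => e e0; have [M hM] := (cvgnP _ _).1 Qu _ e0.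
exists M => n nM; apply: le_lt_trans (hM n nM) => /=.
(* As [w] is orthogonal to [mul Q^**], removing the projection from [Q (u n) - w] leaves
   [Q_reg (u n) - w], and this removal is a contraction. *)
have := orthproj_contract mul_linear mul_closed (Q (u n) - w).
suff -> : orthproj N (Q (u n) - w) = orthproj N (Q (u n)) by rewrite addrAC.
rewrite addrC -scaleN1r (orthproj_comb mul_linear mul_closed).
by rewrite (orthproj0 mul_linear mul_closed w0) scaler0 add0r.
Qed.

(** A vector of [mul] of the closed regular part lies in [mul Q^**] and is orthogonal to it. *)
Lemma reg_closable : closable_op (reg_op Q).
Proof.
apply/seteqP; split=> [w /closure_reg_graph[Nw w0]|_ ->] /=.
  by apply: rn_eq0; apply/eqP; rewrite -sqrf_eq0 -Re_dotE w0.
apply/closure_reg_graph; split=> [|z _]; last by rewrite dot0l.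
exact: closure_graph0.
Qed.

End ClosureGraph.

(* Q1 is a contraction applied to Q2, so a sequence u_k -> 0 along which Q2 u_k
   converges to the singular part of Q2 phi makes Q1 u_k converge as well. *)
Lemma reg_mono (R : realType) (H K1 K2 : hilbertType R) (Q1 : operator H K1)
    (Q2 : operator H K2) : linear_op Q1 -> linear_op Q2 ->
  odom Q2 `<=` odom Q1 ->
  (forall phi, odom Q2 phi -> rn (Q1 phi) <= rn (Q2 phi)) ->
  forall phi, odom Q2 phi -> rn (reg_op Q1 phi) <= rn (reg_op Q2 phi).
Proof.
move=> lin1 lin2 sub le12 phi Dphi.
have := orthproj_in (mul_linear lin2) (@mul_closed _ _ _ Q2) (Q2 phi).
move=> /closure_graphP[u [Du u0 Qu]].
have [w Q1w] : exists w : K1, Q1 (u n) @[n --> \oo] --> w.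
  apply: cauchyn_cvg => e e0; have [N hN] := cvg_cauchyn Qu e0.
  exists N => m n Nm Nn; apply: le_lt_trans (hN m n Nm Nn).
  rewrite -!opB //; try exact: sub.
  by apply: le12; exact: (lin_subsetB lin2.1).
have mw : mul (closure (graph Q1)) w.
  by apply/closure_graphP; exists u; split=> // n; exact: sub.
(* The vector [w] competes with the projection, so [|Q1_reg phi| <= |Q1 phi - w|]. The right side is
   the limit of [|Q1 (phi - u n)|], dominated by [|Q2 (phi - u n)|], which tends to
   [|Q2_reg phi|]. *)
apply: (le_trans (orthproj_best (mul_linear lin1) (@mul_closed _ _ _ Q1) _ mw)).
have c1 : Q1 phi - Q1 (u n) @[n --> \oo] --> Q1 phi - w.
  by apply: cvgn_sub => //; exact: cvg_cst.
have c2 : Q2 phi - Q2 (u n) @[n --> \oo] --> reg_op Q2 phi.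
  by apply: cvgn_sub => //; exact: cvg_cst.
apply: (cvg_real_le2 (cvg_rn c1) (cvg_rn c2)); exists 0%N => n _.
rewrite -!opB //; try exact: sub.
by apply: le12; exact: (lin_subsetB lin2.1).
Qed.

(** * The closure of a closable operator *)

Section ClosureOperator.
Variables (R : realType) (H K : hilbertType R) (Q : operator H K).

(** For closable [Q] this is the operator with graph Q^**; without closability [xget] takes some
    value of that relation. *)
Definition clop : operator H K := Operator
  [set x | exists y, closure (graph Q) (x, y)]
  (fun x => xget 0 [set y | closure (graph Q) (x, y)]).

Hypotheses (linQ : linear_op Q) (clQ : closable_op Q).

Lemma closure_graph_unique x y y' :
  closure (graph Q) (x, y) -> closure (graph Q) (x, y') -> y = y'.
Proof.
move=> c1 c2; have := closure_graphB linQ c1 c2; rewrite subrr => c3.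
have : mul (closure (graph Q)) (y - y') by [].
by rewrite clQ => /= /eqP; rewrite subr_eq0 => /eqP.
Qed.

Lemma clopP x : odom clop x -> closure (graph Q) (x, clop x).
Proof. by move=> ex; exact: (xgetPex 0 ex). Qed.

Lemma clop_eq x y : closure (graph Q) (x, y) -> odom clop x /\ clop x = y.
Proof.
move=> cxy; have ex : odom clop x by exists y.
by split=> //; exact: closure_graph_unique (clopP ex) cxy.
Qed.

Lemma clop_ext x : odom Q x -> odom clop x /\ clop x = Q x.
Proof. by move=> Dx; apply: clop_eq; exact: graph_closure. Qed.

Lemma graph_clop : graph clop = closure (graph Q).
Proof.
apply/seteqP; split=> -[x y] /=; first by move=> [Dx /= ->]; exact: clopP.
by move=> /clop_eq[Dx <-]; split.
Qed.

Lemma clop_closed : closed_op clop.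
Proof. by rewrite /closed_op graph_clop; exact: closed_closure. Qed.

Lemma clop_linear : linear_op clop.
Proof.
split=> [|a u v /clopP cu /clopP cv]; last first.
  exact: (clop_eq (closure_graph_comb linQ (a := a) cu cv)).2.
split=> [|a u v /clopP cu /clopP cv].
  exact: (clop_eq (closure_graph0 linQ)).1.
exact: (clop_eq (closure_graph_comb linQ (a := a) cu cv)).1.
Qed.

Lemma clop_approx x : odom clop x -> exists u : nat -> H,
  [/\ forall n, odom Q (u n), u n @[n --> \oo] --> x
    & Q (u n) @[n --> \oo] --> clop x].
Proof. by move=> /clopP/closure_graphP. Qed.

End ClosureOperator.

(** * Forms represented by operators *)

Section FilterQuadratic.
Variables (R : realType) (T : Type) (F : set_system T).
Hypothesis FF : Filter F.

Lemma cvg_real0P (a : T -> R) :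
  ((a x)%:C : R[i]^o) @[x --> F] --> (0 : R[i]^o) <-> a x @[x --> F] --> 0.
Proof.
split=> /cvgrPdist_lt a0; apply/cvgrPdist_lt => e e0.
  have e0' : (0 : R[i]) < e%:C by rewrite ltcR.
  apply: filterS (a0 _ e0') => x; rewrite !sub0r !normrN.
  by rewrite (rnE ((a x)%:C : R[i]^o)) rn_real ltcR.
have e0' : 0 < Re e by rewrite -ltcR -ge0_complexE ?ltW.
apply: filterS (a0 _ e0') => x; rewrite !sub0r !normrN.
by rewrite (rnE ((a x)%:C : R[i]^o)) rn_real -ltcR -(ge0_complexE (ltW e0)).
Qed.

Lemma cvg_sqr0P (b : T -> R) : (forall x, 0 <= b x) ->
  b x ^+ 2 @[x --> F] --> 0 <-> b x @[x --> F] --> 0.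
Proof.
move=> b0; split=> [/cvgrPdist_lt bb|bb]; last first.
  rewrite -(mulr0 0); exact: (@cvgM _ _ _ _ b b 0 0 bb bb).
apply/cvgrPdist_lt => e e0.
apply: filterS (bb _ (exprn_gt0 2 e0)) => x; rewrite !sub0r !normrN.
rewrite !ger0_norm ?sqr_ge0 // ltr_pXn2r ?nnegrE ?b0 //; exact: ltW.
Qed.

(** The summand with [a] vanishes in the limit whatever the sign of [c]. The filter is general so as
    to cover limits in [n] as well as double limits in [(m, n)]. *)
Lemma cvg_quadratic (a b : T -> R) (c : R) : (forall x, 0 <= b x) ->
  a x @[x --> F] --> 0 ->
  ((c * a x ^+ 2 + b x ^+ 2)%:C : R[i]^o) @[x --> F] --> (0 : R[i]^o) <->
  b x @[x --> F] --> 0.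
Proof.
move=> b0 a0; rewrite cvg_real0P.
have ca : c * a x ^+ 2 @[x --> F] --> 0.
  rewrite -(mulr0 c); apply: (@cvgM _ _ _ _ (fun=> c) _ c 0).
    exact: cvg_cst.
  by rewrite -(mulr0 0); exact: (@cvgM _ _ _ _ a a 0 0 a0 a0).
rewrite -(cvg_sqr0P b0); split=> h.
  have hb : (c * a x ^+ 2 + b x ^+ 2) - c * a x ^+ 2 @[x --> F] --> (0 - 0 : R).
    exact: cvgB h ca.
  have e x : (c * a x ^+ 2 + b x ^+ 2) - c * a x ^+ 2 = b x ^+ 2.
    by rewrite addrC addKr.
  by rewrite (eq_cvg _ _ e) subrr in hb.
by rewrite -(addr0 0); exact: cvgD ca h.
Qed.

End FilterQuadratic.

Lemma cvg_double0P (R : realType) (f : nat * nat -> R) :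
  f p @[p --> (\oo, \oo)] --> (0 : R) <->
  forall e : R, 0 < e -> exists N, forall m n, (N <= m)%N -> (N <= n)%N ->
    `|f (m, n)| < e.
Proof.
split=> [/cvgrPdist_lt f0 e e0|f0].
  have [[A B] /= [[N1 _ h1] [N2 _ h2]] AB] := f0 _ e0.
  exists (maxn N1 N2) => m n; rewrite !geq_max => /andP[m1 m2] /andP[n1 n2].
  by have := AB (m, n) (conj (h1 _ m1) (h2 _ n2)); rewrite /= sub0r normrN.
apply/cvgrPdist_lt => e e0; have [N hN] := f0 _ e0.
exists ([set m | (N <= m)%N], [set n | (N <= n)%N]).
  by split; exists N.
by move=> [m n] [/= mN nN]; rewrite sub0r normrN hN.
Qed.

Section Represented.
Variables (R : realType) (H K : hilbertType R) (t : sesqform H) (c : R).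
Variable Q : operator H K.
Hypotheses (linQ : linear_op Q) (tQ : represents t c Q).

Lemma rep_val u v : odom Q u -> odom Q v ->
  t u v = c%:C * '[u, v] + '[Q u, Q v].
Proof. by rewrite -tQ.1; exact: tQ.2. Qed.

Lemma rep_sqr u : odom Q u -> t u u = (c * rn u ^+ 2 + rn (Q u) ^+ 2)%:C.
Proof. by move=> Du; rewrite rep_val // !dotE -rmorphM -rmorphD. Qed.

Lemma rep_form : is_form t.
Proof.
rewrite /is_form tQ.1; split; first exact: linQ.1.
- move=> a u v w Du Dv Dw; rewrite !rep_val //; last exact: linQ.1.2.
  rewrite op_comb // !dotDl !dotZl; ring.
- move=> a u v w Du Dv Dw; rewrite !rep_val //; last exact: linQ.1.2.
  rewrite op_comb // !dotDr !dotZr; ring.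
Qed.

Lemma rep_lower_bound : lower_bound c t.
Proof.
move=> u; rewrite tQ.1 => Du; rewrite rep_sqr // rnE.
by rewrite -(rmorphXn (real_complex R)) -rmorphM lecR lerDl sqr_ge0.
Qed.

Lemma rep_semibounded : semibounded t.
Proof. by split; [exact: rep_form|exists c; exact: rep_lower_bound]. Qed.

(** Convergence with respect to [t] is convergence in the graph norm of [Q], the term with [c] being
    negligible; closedness and closability of forms thereby become those of operators. *)
Lemma rep_cvg u phi : form_cvg t u phi <->
  [/\ forall n, odom Q (u n), u n @[n --> \oo] --> phi & cauchyn (Q \o u)].
Proof.
have linD := linQ.1; rewrite /form_cvg tQ.1.
suff eqv : (forall n, odom Q (u n)) -> u n @[n --> \oo] --> phi ->
    t (u p.1 - u p.2) (u p.1 - u p.2) @[p --> (\oo, \oo)] --> (0 : R[i]^o) <->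
    cauchyn (Q \o u).
  by split=> -[Du up cu]; split=> //; apply/eqv.
move=> Du up.
have e (p : nat * nat) : (t (u p.1 - u p.2) (u p.1 - u p.2) : R[i]^o) =
    (c * rn (u p.1 - u p.2) ^+ 2 + rn (Q (u p.1) - Q (u p.2)) ^+ 2)%:C.
  by rewrite rep_sqr ?opB //; exact: lin_subsetB.
rewrite (eq_cvg _ _ e) cvg_quadratic; first 1 last.
- by move=> p; exact: rn_ge0.
- apply/cvg_double0P => r r0; have [N hN] := cvg_cauchyn up r0.
  by exists N => m n mN nN; rewrite ger0_norm ?rn_ge0 // hN.
rewrite cvg_double0P; split=> h r r0; have [N hN] := h r r0;
  exists N => m n mN nN.
  by have := hN m n mN nN; rewrite ger0_norm // rn_ge0.
by rewrite ger0_norm ?rn_ge0 //; exact: hN.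
Qed.

Lemma rep_cvg0 u phi : (forall n, odom Q (u n)) -> odom Q phi ->
  u n @[n --> \oo] --> phi ->
  t (u n - phi) (u n - phi) @[n --> \oo] --> (0 : R[i]^o) <->
  Q (u n) @[n --> \oo] --> Q phi.
Proof.
move=> Du Dp up.
have e n : (t (u n - phi) (u n - phi) : R[i]^o) =
    (c * rn (u n - phi) ^+ 2 + rn (Q (u n) - Q phi) ^+ 2)%:C.
  by rewrite rep_sqr ?opB //; exact: (lin_subsetB linQ.1).
rewrite (eq_cvg _ _ e) cvg_quadratic; first by rewrite -cvg_rn0.
- by move=> n; exact: rn_ge0.
- exact/cvg_rn0.
Qed.

Lemma rep_closed : closed_op Q -> closed_form t.
Proof.
move=> clQ u phi /rep_cvg[Du up /cauchyn_cvg[y Qy]].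
have [Dphi yE] : graph Q (phi, y).
  by apply: clQ; apply/closure_graphP; exists u.
rewrite tQ.1; split=> //; apply/(rep_cvg0 Du Dphi up).
by rewrite -yE.
Qed.

Lemma rep_closable : closable_op Q -> closable_form t.
Proof.
move=> clQ u /rep_cvg[Du u0 /cauchyn_cvg[y Qy]].
have y0 : y = 0.
  have : mul (closure (graph Q)) y by apply/closure_graphP; exists u.
  by rewrite clQ.
have D0 := lin_subset0 linQ.1.
have := (rep_cvg0 Du D0 u0).2; rewrite op0 // -y0 => /(_ Qy).
have e n : t (u n - 0) (u n - 0) = t (u n) (u n) :> R[i]^o by rewrite subr0.
by rewrite (eq_cvg _ _ e).
Qed.

End Represented.

Lemma op_form_rep (R : realType) (H K : hilbertType R) (c : R)
  (Q : operator H K) : represents (op_form c Q) c Q.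
Proof. by []. Qed.

(** A competing closed extension in the definition of the closure is given without an operator; this
    supplies one, for the lower bound of that extension. *)
Lemma semibounded_represented (R : realType) (H : hilbertType R)
    (t : sesqform H) (c : R) : is_form t -> lower_bound c t ->
  exists (K : hilbertType R) (Q : operator H K),
    linear_op Q /\ represents t c Q.
Proof.
move=> [linD tl tr] lb.
pose q (u v : H) := t u v - c%:C * '[u, v].
have ql a u v w : fdom t u -> fdom t v -> fdom t w ->
    q (a *: u + v) w = a * q u w + q v w.
  by move=> Du Dv Dw; rewrite /q tl // dotDl dotZl; ring.
have qr a u v w : fdom t u -> fdom t v -> fdom t w ->
    q w (a *: u + v) = Num.conj a * q w u + q w v.
  by move=> Du Dv Dw; rewrite /q tr // dotDr dotZr; ring.
have q0 u : fdom t u -> 0 <= q u u.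
  by move=> Du; rewrite /q subr_ge0 hdotxx lb.
(* Polarization: a form with real diagonal is hermitian. *)
have qC u v : fdom t u -> fdom t v -> q u v = Num.conj (q v u).
  move=> Du Dv.
  have im a : Im (Num.conj a * q u v + a * q v u) = 0.
    have Dw : fdom t (a *: v + u) by exact: linD.2.
    have := ger0_Im (q0 _ Dw).
    rewrite ql // qr // qr //.
    rewrite (_ : a * _ + _ = a * Num.conj a * q v v + q u u +
      (Num.conj a * q u v + a * q v u)); last by ring.
    rewrite conj_sqr.
    have ImD (z w : R[i]) : Im (z + w) = Im z + Im w by case: z w => [? ?] [].
    rewrite ImD [Im (_ + q u u)]ger0_Im ?add0r //.
    by rewrite addr_ge0 ?q0 // mulr_ge0 ?q0 ?exprn_ge0.
  (* [a = 1] makes the imaginary parts of [q u v] and [q v u] opposite, [a = i] makes their real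
     parts equal. *)
  have := im 1; have := im 'i%C; rewrite !conjE.
  case: (q u v) (q v u) => [x y] [x' y'] /= h1 h2.
  apply/eqP; rewrite eq_complex /=; apply/andP; split; apply/eqP; lra.
have qs : semi_dot (fdom t) q by split.
have [K [j [jl jq]]] := hilbert_completion qs.
exists K, (Operator (fdom t) j); split; first by split.
by split=> // u v Du Dv /=; rewrite jq // /q addrC subrK.
Qed.

(** * The closure of a form through its operator *)

Section Closure.
Variables (R : realType) (H K : hilbertType R) (c : R) (Q : operator H K).
Hypotheses (linQ : linear_op Q) (clQ : closable_op Q).

Lemma op_form_closure : is_closure (op_form c Q) (op_form c (clop Q)).
Proof.
have linC := clop_linear linQ clQ; have repC := op_form_rep c (clop Q).
split.
- exact: (rep_semibounded linC repC).
- exact: (rep_closed linC repC (clop_closed linQ clQ)).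
- split=> [u Du|u v Du Dv]; first exact: (clop_ext linQ clQ Du).1.
  have [Du' uE] := clop_ext linQ clQ Du; have [Dv' vE] := clop_ext linQ clQ Dv.
  by rewrite [RHS](rep_val repC) // uE vE.
(* Minimality: a sequence converging in the graph norm of [Q] converges with respect to any closed
   extension [s], so its limit lies in [dom s]. The values agree as limits of equal values, although
   [s] comes with its own bound and operator. *)
move=> s [sform [c' slb]] scl [sdom sval].
have [K' [Q' [linQ' repQ']]] := semibounded_represented sform slb.
have sub u : odom Q u -> odom Q' u by move=> /sdom; rewrite repQ'.1.
have appr phi : odom (clop Q) phi -> exists u : nat -> H,
    [/\ forall n, odom Q (u n), u n @[n --> \oo] --> phi,
        Q (u n) @[n --> \oo] --> clop Q phi, odom Q' phi &
        Q' (u n) @[n --> \oo] --> Q' phi].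
  move=> /clop_approx[u [Du up Qu]]; exists u.
  have uc : form_cvg (op_form c Q) u phi.
    apply/(rep_cvg linQ (op_form_rep c Q)); split=> //.
    exact: cvg_cauchyn Qu.
  have us : form_cvg s u phi.
    case: uc => [_ _ uc]; split=> // [n|]; first exact: (sdom _ (Du n)).
    have e (p : nat * nat) : (s (u p.1 - u p.2) (u p.1 - u p.2) : R[i]^o) =
        op_form c Q (u p.1 - u p.2) (u p.1 - u p.2).
      by rewrite -sval //; exact: (lin_subsetB linQ.1).
    by rewrite (eq_cvg _ _ e).
  have [sp s0] := scl _ _ us; have Dp : odom Q' phi by rewrite -repQ'.1.
  by split=> //; apply/(rep_cvg0 linQ' repQ') => // n; exact: sub.
split=> [phi /appr[u [_ _ _ Dp _]]|]; first by rewrite repQ'.1.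
move=> phi psi /appr[u [Du up Qu Dp Qu']] /appr[v [Dv vp Qv Dp' Qv']] /=.
rewrite (rep_val repQ' Dp Dp').
have lim (V : hilbertType R) (P : operator H V) (a : R) (x y : V) :
    P (u n) @[n --> \oo] --> x -> P (v n) @[n --> \oo] --> y ->
    (a%:C *: ('[u n, v n] : R[i]^o) + '[P (u n), P (v n)]) @[n --> \oo] -->
    (a%:C *: ('[phi, psi] : R[i]^o) + '[x, y] : R[i]^o).
  by move=> Pu Pv; exact: cvgn_comb (cvg_dot up vp) (cvg_dot Pu Pv).
have l1 := lim _ Q c _ _ Qu Qv; have l2 := lim _ Q' c' _ _ Qu' Qv'.
apply: (cvgn_unique l1).
have e n : (c%:C *: ('[u n, v n] : R[i]^o) + '[Q (u n), Q (v n)]) =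
    c'%:C *: ('[u n, v n] : R[i]^o) + '[Q' (u n), Q' (v n)].
  have := sval (u n) (v n) (Du n) (Dv n).
  by rewrite (rep_val repQ') //; exact: sub.
by rewrite (eq_cvg _ _ e).
Qed.

Lemma is_closure_unique (t s s' : sesqform H) :
  is_closure t s -> is_closure t s' ->
  fdom s = fdom s' /\ forall u v, fdom s u -> fdom s v -> s u v = s' u v.
Proof.
move=> [s1 s2 s3 s4] [s1' s2' s3' s4'].
have [d v] := s4 _ s1' s2' s3'; have [d' _] := s4' _ s1 s2 s3.
by split=> //; apply/seteqP.
Qed.

Lemma clos_rep : represents (clos (op_form c Q)) c (clop Q).
Proof.
have := xgetPex (op_form c Q) (ex_intro _ _ op_form_closure).
move=> /is_closure_unique/(_ op_form_closure)[d v].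
by split=> [//|u w Du Dw]; rewrite [LHS]v.
Qed.

End Closure.

(** * Monotone limits *)

Section MonotoneLimit.
Variables (R : realType) (H : hilbertType R) (K : nat -> hilbertType R).
Variable T : forall n, operator H (K n).
Hypothesis linT : forall n, linear_op (T n).
Hypothesis subT : forall m n, (m <= n)%N -> odom (T n) `<=` odom (T m).
Hypothesis leT : forall m n phi, (m <= n)%N -> odom (T n) phi ->
  rn (T m phi) <= rn (T n phi).

Definition limit_dom : set H :=
  [set phi | (forall n, odom (T n) phi) /\
             exists M : R, forall n, rn (T n phi) <= M].

Lemma limit_dom_linear : linear_subset limit_dom.
Proof.
split=> [|a u v [Du [M uM]] [Dv [M' vM]]].
  split=> [n|]; first exact: (lin_subset0 (linT n).1).
  by exists 0 => n; rewrite op0 // rn0.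
split=> [n|]; first exact: (linT n).1.2.
exists (rn (a : R[i]^o) * M + M') => n; rewrite op_comb //.
apply: (le_trans (rnD _ _)); rewrite rnZ lerD //.
by rewrite ler_wpM2l ?rn_ge0.
Qed.

Let sqr_cauchy phi (e : R) : limit_dom phi -> 0 < e ->
  exists N, forall m n, (N <= m)%N -> (m <= n)%N ->
    rn (T n phi) ^+ 2 - rn (T m phi) ^+ 2 < e.
Proof.
move=> [Dphi [M phiM]] e0.
apply: (@bounded_mono_cauchy _ (fun n => rn (T n phi) ^+ 2) (M ^+ 2)) => //.
  by move=> m n mn; rewrite ler_pXn2r ?nnegrE ?rn_ge0 // leT.
move=> n; rewrite ler_pXn2r ?nnegrE ?rn_ge0 //.
exact: le_trans (rn_ge0 _) (phiM n).
Qed.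

Let dot_limit phi psi : limit_dom phi -> limit_dom psi ->
  exists z : R[i]^o, ('[T n phi, T n psi] : R[i]^o) @[n --> \oo] --> z.
Proof.
move=> Lphi Lpsi; have [Dphi _] := Lphi; have [Dpsi _] := Lpsi.
(* The increments of the forms are nonnegative forms themselves. *)
pose d m n u v : R[i] := '[T n u, T n v] - '[T m u, T m v].
have sd m n : (m <= n)%N -> semi_dot (odom (T n)) (d m n).
  move=> mn; split; first exact: (linT n).1.
  - move=> a u v w Du Dv Dw; have sub := subT mn.
    rewrite /d (op_comb (linT n)) // (op_comb (linT m)); [|exact: sub..].
    by rewrite !dotDl !dotZl; ring.
  - by move=> u v _ _; rewrite /d rmorphB /= -!dotC.
  - move=> u Du; rewrite /d !dotE -rmorphB ler0c subr_ge0.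
    by rewrite ler_pXn2r ?nnegrE ?rn_ge0 // leT.
have dlt m n u e : (m <= n)%N -> odom (T n) u -> 0 < e ->
    rn (T n u) ^+ 2 - rn (T m u) ^+ 2 < e ^+ 2 -> fnorm (d m n) u < e.
  by move=> mn Du e0; rewrite (fnorm_lt (sd _ _ mn)) // /d ReB !Re_dotE.
apply: cauchyn_cvgC => e e0.
(* Cauchy-Schwarz for the increment bounds the difference by a product of two seminorms, each made
   smaller than [r]. *)
pose r := Num.sqrt e; have r0 : 0 < r by rewrite sqrtr_gt0.
have [N1 h1] := sqr_cauchy Lphi (exprn_gt0 2 r0).
have [N2 h2] := sqr_cauchy Lpsi (exprn_gt0 2 r0).
have main m n : (maxn N1 N2 <= m)%N -> (m <= n)%N ->
    rn ('[T n phi, T n psi] - '[T m phi, T m psi] : R[i]^o) < e.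
  rewrite geq_max => /andP[m1 m2] mn.
  have := fnorm_cs (sd _ _ mn) (Dphi n) (Dpsi n).
  move=> /le_lt_trans; apply.
  rewrite -(sqr_sqrtr (ltW e0)) -/r expr2.
  apply: ltr_pM; rewrite ?fnorm_ge0 //.
    by apply: dlt => //; exact: h1.
  by apply: dlt => //; exact: h2.
exists (maxn N1 N2) => m n Nm Nn.
have [mn|nm] := leqP m n; first by rewrite rnB main.
by rewrite main // ltnW.
Qed.

(** The [T n] act into unrelated spaces and have no limit themselves; the inner products
    ['[T n u, T n v]] do converge, and completing the limit form yields a space for [S]. *)
Lemma monotone_limit : exists (Ks : hilbertType R) (S : operator H Ks),
  [/\ linear_op S, odom S = limit_dom &
      forall phi, limit_dom phi ->
        rn (T n phi) ^+ 2 @[n --> \oo] --> rn (S phi) ^+ 2].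
Proof.
have /choice[g gP] (p : H * H) : exists z : R[i]^o,
    limit_dom p.1 -> limit_dom p.2 ->
    ('[T n p.1, T n p.2] : R[i]^o) @[n --> \oo] --> z.
  have [[L1 L2]|nL] := pselect (limit_dom p.1 /\ limit_dom p.2).
    by have [z pz] := dot_limit L1 L2; exists z.
  by exists 0 => L1 L2; exfalso; apply: nL.
pose q u v : R[i] := g (u, v).
have qP u v : limit_dom u -> limit_dom v ->
    ('[T n u, T n v] : R[i]^o) @[n --> \oo] --> (q u v : R[i]^o).
  by move=> Lu Lv; exact: (gP (u, v)).
have sq : semi_dot limit_dom q.
  split; first exact: limit_dom_linear.
  - move=> a u v w Lu Lv Lw; have Luv := limit_dom_linear.2 a _ _ Lu Lv.
    apply: (cvgn_unique (qP _ _ Luv Lw)).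
    have e n : ('[T n (a *: u + v), T n w] : R[i]^o) =
        a *: ('[T n u, T n w] : R[i]^o) + '[T n v, T n w].
      by rewrite op_comb ?dotDl ?dotZl //; [exact: Lu.1|exact: Lv.1].
    rewrite (eq_cvg _ _ e).
    exact: (cvgn_comb (qP _ _ Lu Lw) (qP _ _ Lv Lw)).
  - move=> u v Lu Lv; apply: (cvgn_unique (qP _ _ Lu Lv)).
    have e n : ('[T n u, T n v] : R[i]^o) = Num.conj '[T n v, T n u].
      exact: dotC.
    by rewrite (eq_cvg _ _ e); exact: cvg_conj (qP _ _ Lv Lu).
  - move=> u Lu; apply: cvg_ge0 (qP _ _ Lu Lu) => n.
    by rewrite dotE ler0c sqr_ge0.
have [Ks [j [jl jq]]] := hilbert_completion sq.
exists Ks, (Operator limit_dom j); split=> //.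
  by split=> //; exact: limit_dom_linear.
move=> phi Lphi; have := cvg_Re (qP _ _ Lphi Lphi).
have e n : Re '[T n phi, T n phi] = rn (T n phi) ^+ 2 by rewrite Re_dotE.
by rewrite (eq_cvg _ _ e) -(jq _ _ Lphi Lphi) Re_dotE.
Qed.

Section Limit.
Variables (Ks : hilbertType R) (S : operator H Ks).
Hypotheses (linS : linear_op S) (domS : odom S = limit_dom).
Hypothesis limS : forall phi, limit_dom phi ->
  rn (T n phi) ^+ 2 @[n --> \oo] --> rn (S phi) ^+ 2.

Lemma limit_ge n phi : odom S phi -> rn (T n phi) <= rn (S phi).
Proof.
rewrite domS => Lphi; rewrite -(@ler_pXn2r _ 2) ?nnegrE ?rn_ge0 //.
apply: (cvg_real_le2 (cvgn_cst _) (limS Lphi)); exists n => m nm.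
rewrite ler_pXn2r ?nnegrE ?rn_ge0 // leT //; exact: Lphi.1.
Qed.

Lemma limit_le phi (M : R) : odom S phi ->
  (forall n, rn (T n phi) <= M) -> rn (S phi) <= M.
Proof.
rewrite domS => Lphi TM.
have M0 : 0 <= M by exact: le_trans (rn_ge0 _) (TM 0%N).
rewrite -(@ler_pXn2r _ 2) ?nnegrE ?rn_ge0 //.
apply: (cvg_real_le (limS Lphi)); exists 0%N => n _.
by rewrite ler_pXn2r ?nnegrE ?rn_ge0.
Qed.

(** Since [|T n v| <= |S v|], a sequence Cauchy for [S] is Cauchy for every [T n] at a rate
    independent of [n]. Closedness of the [T n] catches the limit, and the common rate passes to [S]
    because [|S v|] is the supremum of the [|T n v|]. *)
Lemma limit_closed : (forall n, closed_op (T n)) -> closed_op S.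
Proof.
move=> clT; have linD := linS.1.
apply/closure_id/seteqP; split; first exact: subset_closure.
move=> [phi y] /closure_graphP[u [Du up Su]].
have DT n v : odom S v -> odom (T n) v by rewrite domS => -[].
have Tcvg n : odom (T n) phi /\ T n (u k) @[k --> \oo] --> T n phi.
  have [|w Tw] := @cauchyn_cvg _ _ (fun k => T n (u k)).
    move=> e e0; have [N hN] := cvg_cauchyn Su e0; exists N => k l kN lN.
    apply: le_lt_trans (hN k l kN lN).
    rewrite -(opB (linT n)) -?(opB linS) //; try exact: DT.
    by apply: limit_ge; exact: lin_subsetB.
  have [Dphi /= wE] : graph (T n) (phi, w).
    by apply: clT; apply/closure_graphP; exists u; split=> // k; exact: DT.
  by split=> //; rewrite -wE.
have small e : 0 < e -> exists N, forall k, (N <= k)%N ->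
    forall n, rn (T n (u k) - T n phi) <= e.
  move=> e0; have [N hN] := cvg_cauchyn Su e0; exists N => k kN n.
  rewrite rnB; apply: cvg_rn_le (Tcvg n).2 _; exists N => l lN.
  apply: le_trans (ltW (hN l k lN kN)).
  rewrite -(opB (linT n)) -?(opB linS) //; try exact: DT.
  by apply: limit_ge; exact: lin_subsetB.
have Lphi : odom S phi.
  rewrite domS; split=> [n|]; first exact: (Tcvg n).1.
  have [N hN] := small 1 ltr01; exists (1 + rn (S (u N))) => n.
  have := rnD (T n phi - T n (u N)) (T n (u N)); rewrite subrK.
  move=> /le_trans; apply; apply: lerD; last exact: limit_ge.
  by rewrite rnB hN.
have Sphi : S (u n) @[n --> \oo] --> S phi.
  apply/cvgnP => e e0; have [N hN] := small (e / 2) (divr_gt0 e0 (ltr0Sn _ 1)).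
  exists N => n nN; apply: (@le_lt_trans _ _ (e / 2)); last by lra.
  rewrite -opB //; apply: limit_le; first exact: lin_subsetB.
  move=> m; rewrite opB //; [exact: hN|exact: DT|exact: DT].
by split=> //=; exact: cvgn_unique Su Sphi.
Qed.

End Limit.

End MonotoneLimit.

(** * Selfadjoint relations and resolvents *)

Section Selfadjoint.
Variables (R : realType) (H : hilbertType R).
Implicit Types (A B : set (H * H)) (f h : H).

Lemma dot_ext (x y : H) : (forall z, '[x, z] = '[y, z]) -> x = y.
Proof.
move=> xy; apply/eqP; rewrite -subr_eq0; apply/eqP/rn_eq0/eqP.
by rewrite -sqrf_eq0 -Re_dotE dotBl xy subrr.
Qed.

(** For [(k, h)] in the adjoint, solve for [x] with [(x, h - l k + l x)] in [A]; then [k - x] is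
    orthogonal, as [l] is real, to the range of [A - l], which is the whole space. *)
Lemma symmetric_onto_selfadjoint A (l : R) : linear_subset A ->
  A `<=` adjoint A -> (forall f, exists x, A (x, f + l%:C *: x)) ->
  selfadjoint A.
Proof.
move=> linA symA onto; split=> //; apply/seteqP; split=> // -[k h] khA.
have [x xA] := onto (h - l%:C *: k).
have lC : Num.conj l%:C = l%:C by rewrite conjE conjc_real.
have kx : k = x.
  apply: dot_ext => g; have [z zA] := onto g.
  have := khA _ zA; have := symA _ xA _ zA; rewrite /= => e1 e2.
  move: e1 e2; rewrite !dotDr !dotDl dotNl !dotZl !dotZr lC => e1 e2.
  apply: (addIr (l%:C * '[k, z])); rewrite -e2.
  by move/addIr: e1 => <-; rewrite subrK.
by move: xA; rewrite -kx subrK.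
Qed.

(** Passing to adjoints reverses the inclusion. This settles the uniqueness of the selfadjoint
    relations attached to forms. *)
Lemma selfadjoint_sub A B : selfadjoint A -> selfadjoint B -> A `<=` B -> A = B.
Proof.
move=> [_ AE] [_ BE] AB; apply/seteqP; split=> // p; rewrite BE AE => pB q Aq.
exact/pB/AB.
Qed.

Lemma selfadjoint_sym A x y x' y' : selfadjoint A -> A (x, y) -> A (x', y') ->
  '[y, x'] = '[x, y'].
Proof. by move=> [_ AE]; rewrite {1}AE => /(_ (x', y')) h /h. Qed.

Lemma selfadjoint_comb A a x y x' y' : selfadjoint A -> A (x, y) ->
  A (x', y') -> A (a *: x + x', a *: y + y').
Proof. by move=> [[_ lin] _] Axy Axy'; exact: (lin a _ _ Axy Axy'). Qed.

Lemma selfadjointB A x y x' y' : selfadjoint A -> A (x, y) ->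
  A (x', y') -> A (x - x', y - y').
Proof.
move=> sA Axy Axy'; have := selfadjoint_comb (-1) sA Axy' Axy.
by rewrite !scaleN1r ![- _ + _]addrC.
Qed.

Lemma selfadjoint_cvg A (u v : nat -> H) x y : selfadjoint A ->
  (forall n, A (u n, v n)) -> u n @[n --> \oo] --> x ->
  v n @[n --> \oo] --> y -> A (x, y).
Proof.
move=> sA Auv ux vy; rewrite sA.2 => -[x' y'] Axy' /=.
apply: (cvgn_unique (cvg_dot vy (cvgn_cst x'))).
have e n : ('[v n, x'] : R[i]^o) = '[u n, y'].
  exact: (selfadjoint_sym sA (Auv n) Axy').
by rewrite (eq_cvg _ _ e); exact: (cvg_dot ux (cvgn_cst y')).
Qed.

(** As ['[y, x]] is real, the imaginary part of ['[y - l x, x]] is [- Im l |x|^2], and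
    Cauchy-Schwarz applies. *)
Lemma selfadjoint_Im_bound A (l : R[i]) x y : selfadjoint A -> A (x, y) ->
  `|Im l| * rn x <= rn (y - l *: x).
Proof.
move=> sA Axy; have yx := selfadjoint_sym sA Axy Axy.
have im0 : Im '[y, x] = 0.
  have := congr1 (@complex.Im R) (dotC y x); rewrite -yx conjE.
  by case: '[y, x] => a b /=; lra.
have := rn_ge0 x; rewrite le_eqVlt => /predU1P[<-|x0].
  by rewrite mulr0 rn_ge0.
rewrite -(ler_pM2r x0); apply: le_trans (dot_cs _ _).
have Im_le_rn (w : R[i]^o) : `|Im w| <= rn w.
  rewrite -lecR -rnE normc_def lecR -sqrtr_sqr ler_sqrt ?addr_ge0 ?sqr_ge0 //.
  by rewrite lerDr sqr_ge0.
apply: le_trans (Im_le_rn _); rewrite dotBl dotZl dotE.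
rewrite [Im (_ - _)](_ : _ = - (Im l * rn x ^+ 2)).
  by rewrite normrN normrM [`|_ ^+ 2|]ger0_norm ?sqr_ge0 // expr2 mulrA.
move: im0; case: '[y, x] => a b /= ->; case: l => p q /=; ring.
Qed.

Lemma nonreal_Im (l : R[i]) : l \isn't Num.real -> 0 < `|Im l|.
Proof. by case: l => a b; rewrite complex_real normr_gt0. Qed.

(* The range of A - l is closed by the bound above, and its orthogonal
   complement lies in the kernel of A - conj l. *)
Lemma resolvent_exists A (l : R[i]) f : selfadjoint A ->
  l \isn't Num.real -> exists x, A (x, f + l *: x).
Proof.
move=> sA lnr; have l0 := nonreal_Im lnr; have [[A0 linA] AE] := sA.
pose M : set H := [set g | exists x, A (x, g + l *: x)].
have linM : linear_subset M.
  split=> [|a u v [x Ax] [y Ay]].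
    by exists 0; rewrite add0r scaler0.
  exists (a *: x + y); have := selfadjoint_comb a sA Ax Ay.
  by rewrite !scalerDr addrACA !scalerA (mulrC a).
(* The zero operator on [M] makes [y] the projection of [f] onto the closure of the range. *)
pose Z : operator H H := Operator M (fun=> 0).
have linZ : linear_op Z by split=> // a u v _ _ /=; rewrite scaler0 addr0.
have [y [w [/closure_graphP[u [Mu uy _]] yP]]] := form_minimizer linZ f.
have /choice[x xA] := Mu.
have [x0 xx0] : exists x0 : H, x n @[n --> \oo] --> x0.
  apply: cauchyn_cvg => e e0.
  have [N hN] := cvg_cauchyn uy (mulr_gt0 e0 l0); exists N => m n mN nN.
  rewrite -(ltr_pM2r l0); apply: le_lt_trans (hN m n mN nN).
  have := selfadjoint_Im_bound l sA (selfadjointB sA (xA m) (xA n)).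
  by rewrite scalerBr opprD addrACA addrK mulrC.
have My : A (x0, y + l *: x0).
  apply: (selfadjoint_cvg sA xA xx0); rewrite addrC.
  have := cvgn_comb (a := l) xx0 uy; under eq_fun do rewrite addrC; exact.
pose g := f - y.
have gA : A (g, Num.conj l *: g).
  rewrite AE => -[p q] Apq /=.
  have Mp : M (q - l *: p) by exists p; rewrite subrK.
  have := yP _ Mp; rewrite /= dot0r addr0 => e.
  have : '[g, q - l *: p] = 0 by rewrite dotBl e subrr.
  rewrite dotBr dotZr => /eqP; rewrite subr_eq0 => /eqP ->.
  by rewrite dotZl.
have := selfadjoint_Im_bound (Num.conj l) sA gA.
rewrite subrr rn0 => h.
have g0 : g = 0.
  apply: rn_eq0; apply/eqP; rewrite eq_le rn_ge0 andbT.
  rewrite -(pmulr_rle0 _ l0); move: h; rewrite conjE.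
  by case: (l) => ? ? /=; rewrite normrN.
exists x0; move/eqP: g0; rewrite /g subr_eq0 => /eqP ->; exact: My.
Qed.

Lemma resolventP A (l : R[i]) f : selfadjoint A -> l \isn't Num.real ->
  A (resolvent A l f, f + l *: resolvent A l f).
Proof.
move=> sA lnr; have ex := resolvent_exists f sA lnr.
exact: (xgetPex 0 ex).
Qed.

(** The resolvent and an approximant [(u1, u2)] from [A_ n] differ by an element of [A_ n] whose
    image under [A_ n - l] is the defect [f - (u2 - l u1)]. The defect tends to zero, and the bound
    by [Im l] is uniform in [n]. *)
Lemma graph_resolvent_cvg (A_ : nat -> set (H * H)) A :
  strong_graph_cvg A_ A -> strong_resolvent_cvg A_ A.
Proof.
move=> [sA_ sA gA]; split=> // f l lnr; have l0 := nonreal_Im lnr.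
set h := resolvent A l f; have [u uA up] := gA _ (resolventP f sA lnr).
have u1 : (u n).1 @[n --> \oo] --> h.
  by apply: (cvg_comp _ _ up); exact: cvg_fst.
have u2 : (u n).2 @[n --> \oo] --> f + l *: h.
  by apply: (cvg_comp _ _ up); exact: cvg_snd.
have d0 : (u n).2 - l *: (u n).1 @[n --> \oo] --> f.
  have -> : f = (- l) *: h + (f + l *: h) by rewrite scaleNr addrC addrK.
  have := cvgn_comb (a := - l) u1 u2.
  by under eq_fun do rewrite scaleNr addrC; exact.
apply: (cvg_rn_small u1) => e e0.
have [N hN] := (cvgnP _ _).1 d0 _ (mulr_gt0 e0 l0); exists N => n nN.
rewrite -(ltr_pM2r l0); apply: le_lt_trans (hN n nN).
have uA' : A_ n ((u n).1, (u n).2) by rewrite -surjective_pairing.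
have := selfadjoint_Im_bound l (sA_ n)
  (selfadjointB (sA_ n) (resolventP f (sA_ n) lnr) uA').
set r := resolvent _ _ _.
have -> : f + l *: r - (u n).2 - l *: (r - (u n).1) =
    f - ((u n).2 - l *: (u n).1).
  rewrite scalerBr !opprB [f + _ - _]addrAC -[LHS]addrA [l *: r + _]addrC subrK.
  by rewrite -addrA [- _ + _]addrC.
by move=> hb; rewrite mulrC [X in _ <= X]rnB.
Qed.

End Selfadjoint.

(* The relation Q^* Q^** + c. *)
Definition form_graph (R : realType) (H K : hilbertType R) (c : R)
    (Q : operator H K) : set (H * H) :=
  [set p | exists y, closure (graph Q) (p.1, y) /\
     forall psi, odom Q psi -> c%:C * '[p.1, psi] + '[y, Q psi] = '[p.2, psi]].

(** * Selfadjointness of Q^* Q^** + c and its identification with the relation of a form *)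

Section FormRelation.
Variables (R : realType) (H K : hilbertType R) (c : R) (Q : operator H K).
Hypothesis linQ : linear_op Q.
Local Notation A := (form_graph c Q).

(** Both sides depend continuously on the pair [(psi, Q psi)], so the equation persists for test
    pairs in Q^**; this gives symmetry and semiboundedness. *)
Lemma form_graph_ext p y psi w :
  (forall psi, odom Q psi -> c%:C * '[p.1, psi] + '[y, Q psi] = '[p.2, psi]) ->
  closure (graph Q) (psi, w) ->
  c%:C * '[p.1, psi] + '[y, w] = '[p.2, psi] :> R[i].
Proof.
move=> py /closure_graphP[u [Du up Qu]].
have l1 : (c%:C *: ('[p.1, u n] : R[i]^o) + '[y, Q (u n)]) @[n --> \oo] -->
    (c%:C *: ('[p.1, psi] : R[i]^o) + '[y, w] : R[i]^o).
  exact: cvgn_comb (cvg_dot (cvgn_cst p.1) up) (cvg_dot (cvgn_cst y) Qu).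
apply: (cvgn_unique l1).
have e n : (c%:C *: ('[p.1, u n] : R[i]^o) + '[y, Q (u n)]) = '[p.2, u n].
  exact: py.
by rewrite (eq_cvg _ _ e); exact: (cvg_dot (cvgn_cst p.2) up).
Qed.

Lemma form_graph_linear : linear_subset A.
Proof.
split.
  exists 0; split; first exact: closure_graph0.
  by move=> psi Dpsi /=; rewrite !dot0l mulr0 addr0.
move=> a [u u'] [v v'] [y [cy yP]] [z [cz zP]].
exists (a *: y + z); split; first exact: (closure_graph_comb linQ cy cz).
move=> psi Dpsi /=; rewrite !dotDl !dotZl -(yP _ Dpsi) -(zP _ Dpsi) /=; ring.
Qed.

Lemma form_graph_sym : A `<=` adjoint A.
Proof.
move=> p [y [cy yP]] q [z [cz zP]].
rewrite -(form_graph_ext yP cz) [RHS]dotC -(form_graph_ext zP cy).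
by rewrite rmorphD rmorphM /= -!dotC conjE conjc_real.
Qed.

(** Subtracting [(c - 1) '[phi, psi]] from the equation that defines [A] replaces the factor [c] by
    1 and leaves the Euler-Lagrange equation of the minimizer. *)
Lemma form_graph_onto f : exists phi y, [/\ closure (graph Q) (phi, y),
  A (phi, f + (c - 1)%:C *: phi) &
  forall psi, odom Q psi -> '[phi, psi] + '[y, Q psi] = '[f, psi]].
Proof.
have [phi [y [cy yP]]] := form_minimizer linQ f; exists phi, y; split=> //.
exists y; split=> // psi Dpsi /=.
by rewrite dotDl dotZl -yP // rmorphB rmorph1; ring.
Qed.

Lemma form_graph_selfadjoint : selfadjoint A.
Proof.
apply: (symmetric_onto_selfadjoint (l := c - 1)).
- exact: form_graph_linear.
- exact: form_graph_sym.
- by move=> f; have [phi [y [_ Aphi _]]] := form_graph_onto f; exists phi.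
Qed.

Lemma form_graph_semibounded : semibounded_rel A.
Proof.
exists c => p [y [cy yP]]; rewrite -(form_graph_ext yP cy) !dotE rnE.
by rewrite -(rmorphXn (real_complex R)) -rmorphM -rmorphD lecR lerDl sqr_ge0.
Qed.

(** Any candidate for the choice [form_rel] is contained in [A], because its approximating sequences
    make [Q (u n)] converge to some [y]; between selfadjoint relations inclusion is equality. *)
Lemma form_relE (t : sesqform H) : represents t c Q -> form_rel t = A.
Proof.
move=> tQ.
have isA : is_form_rel t A.
  split; first exact: form_graph_selfadjoint.
  move=> p [y [/closure_graphP[u [Du up Qu]] yP]]; exists u.
    by apply/(rep_cvg linQ tQ); split=> //; exact: cvg_cauchyn Qu.
  move=> psi; rewrite tQ.1 => Dpsi; rewrite -yP //.
  have e n : (t (u n) psi : R[i]^o) =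
      c%:C *: ('[u n, psi] : R[i]^o) + '[Q (u n), Q psi] by exact: rep_val.
  rewrite (eq_cvg _ _ e).
  exact: cvgn_comb (cvg_dot up (cvgn_cst psi)) (cvg_dot Qu (cvgn_cst _)).
have [sF FP] := xgetPex set0 (ex_intro _ _ isA).
apply: (selfadjoint_sub sF form_graph_selfadjoint) => p /FP[u].
move=> /(rep_cvg linQ tQ)[Du up /cauchyn_cvg[y Qy]] tu.
exists y; split; first by rewrite closure_graphP; exists u.
move=> psi Dpsi; have := tu psi; rewrite tQ.1 => /(_ Dpsi).
have e n : (t (u n) psi : R[i]^o) =
    c%:C *: ('[u n, psi] : R[i]^o) + '[Q (u n), Q psi] by exact: rep_val.
rewrite (eq_cvg _ _ e) => l1; apply: cvgn_unique l1.
exact: cvgn_comb (cvg_dot up (cvgn_cst psi)) (cvg_dot Qy (cvgn_cst _)).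
Qed.

Lemma closed_form_relE (t : sesqform H) : closed_op Q -> represents t c Q ->
  closed_form_rel t = A.
Proof.
move=> clQ tQ.
have isA : is_closed_form_rel t A.
  split; first exact: form_graph_selfadjoint.
  move=> p [y [/clQ[/= Dp yE] yP]]; rewrite tQ.1; split=> // psi Dpsi.
  by rewrite (rep_val tQ) // -yP // yE.
have [sF FP] := xgetPex set0 (ex_intro _ _ isA).
apply: (selfadjoint_sub sF form_graph_selfadjoint) => p /FP[].
rewrite tQ.1 => Dp pP; exists (Q p.1); split; first exact: graph_closure.
by move=> psi Dpsi; rewrite -(rep_val tQ) // pP.
Qed.

End FormRelation.

(* The defining equation forces y to be orthogonal to mul Q^**. *)
Lemma form_graph_reg (R : realType) (H K : hilbertType R) (c : R)
    (Q : operator H K) : linear_op Q ->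
  form_graph c Q = form_graph c (clop (reg_op Q)).
Proof.
move=> linQ; have linr := reg_linear linQ; have clr := reg_closable linQ.
have linC := clop_linear linr clr.
(* Both relations are selfadjoint, so one inclusion suffices. *)
apply: (selfadjoint_sub (form_graph_selfadjoint c linQ)
  (form_graph_selfadjoint c linC)) => p [y [cy yP]].
have y0 z : mul (closure (graph Q)) z -> '[y, z] = 0.
  by move=> /(form_graph_ext yP); rewrite !dot0r mulr0 add0r.
have cry : closure (graph (reg_op Q)) (p.1, y) by apply/closure_reg_graph.
exists y; split.
  by rewrite (graph_clop linr clr) -(closure_id _).1 //; exact: closed_closure.
move=> psi /clopP /(closure_reg_graph linQ)[cpsi _].
exact: form_graph_ext yP cpsi.
Qed.

(** * Graph convergence for a monotone sequence of closed operators *)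

Section GraphConvergence.
Variables (R : realType) (H : hilbertType R) (K : nat -> hilbertType R).
Variables (T : forall n, operator H (K n)) (c : R).
Hypothesis linT : forall n, linear_op (T n).
Hypothesis clT : forall n, closed_op (T n).
Hypothesis subT : forall m n, (m <= n)%N -> odom (T n) `<=` odom (T m).
Hypothesis leT : forall m n phi, (m <= n)%N -> odom (T n) phi ->
  rn (T m phi) <= rn (T n phi).
Variables (Ks : hilbertType R) (S : operator H Ks).
Hypotheses (linS : linear_op S) (domS : odom S = limit_dom T).
Hypothesis limS : forall phi, limit_dom T phi ->
  rn (T n phi) ^+ 2 @[n --> \oo] --> rn (S phi) ^+ 2.

(* The functional minimized by (A - (c - 1))^-1 f. *)
Let J (K' : hilbertType R) (Q : operator H K') f psi : R :=
  rn psi ^+ 2 + rn (Q psi) ^+ 2 - 2 * Re '[f, psi].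

(** [J] is [|f - psi|^2 + |Q psi|^2] without the constant [|f|^2]. Being quadratic, it exceeds its
    minimum by exactly the squared graph distance to the minimizer. *)
Let J_min (K' : hilbertType R) (Q : operator H K') f x psi : linear_op Q ->
  odom Q x -> odom Q psi ->
  (forall psi, odom Q psi -> '[x, psi] + '[Q x, Q psi] = '[f, psi]) ->
  J Q f psi = J Q f x + (rn (psi - x) ^+ 2 + rn (Q psi - Q x) ^+ 2).
Proof.
move=> linQ Dx Dpsi xP; rewrite /J -(xP _ Dpsi) -(xP _ Dx) -!Re_dotE.
have sym (V : hilbertType R) (a b : V) : Re '[a, b] = Re '[b, a].
  by rewrite dotC Re_conjc.
rewrite !dotBl !dotBr !(ReB, ReD) (sym _ psi x) (sym _ (Q psi) (Q x)). ring.
Qed.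

Lemma form_graph_cvg p : form_graph c S p ->
  exists2 u : nat -> H * H, forall n, form_graph c (T n) (u n)
    & u n @[n --> \oo] --> p.
Proof.
move=> [y [cy yP]].
have clS := limit_closed linT leT linS domS limS clT.
have [/= Dp yE] : graph S (p.1, y) by exact: clS.
rewrite {}yE {cy} in yP.
(* With this [f] the first component of [p] minimizes [J S f]; the minimizers [x n] for the same [f]
   are to converge to it. *)
pose f := p.2 - (c - 1)%:C *: p.1.
have fP psi : odom S psi -> '[p.1, psi] + '[S p.1, S psi] = '[f, psi].
  by move=> Dpsi; rewrite dotBl dotZl -yP // rmorphB rmorph1; ring.
have /choice[x xP] n : exists x, [/\ odom (T n) x,
    form_graph c (T n) (x, f + (c - 1)%:C *: x) &
    forall psi, odom (T n) psi -> '[x, psi] + '[T n x, T n psi] = '[f, psi]].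
  have [phi [z [cz Aphi zP]]] := form_graph_onto c (linT n) f.
  have [/= Dphi zE] : graph (T n) (phi, z) by exact: clT.
  by exists phi; split=> // psi Dpsi; rewrite -zE zP.
have Dx n : odom (T n) (x n) by case: (xP n).
have ST n v : odom S v -> odom (T n) v by rewrite domS => -[].
have Jmin n psi : odom (T n) psi -> J (T n) f psi =
    J (T n) f (x n) + (rn (psi - x n) ^+ 2 + rn (T n psi - T n (x n)) ^+ 2).
  by move=> Dpsi; apply: J_min => //; case: (xP n).
have Jle m n psi : (m <= n)%N -> odom (T n) psi ->
    J (T m) f psi <= J (T n) f psi.
  move=> mn Dpsi; rewrite /J lerD2r lerD2l ler_pXn2r ?nnegrE ?rn_ge0 //.
  exact: leT.
have JleS n psi : odom S psi -> J (T n) f psi <= J S f psi.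
  move=> Dpsi; rewrite /J lerD2r lerD2l ler_pXn2r ?nnegrE ?rn_ge0 //.
  exact: (limit_ge leT domS limS).
pose j n := J (T n) f (x n).
have jS n : j n <= J S f p.1.
  apply: le_trans (JleS n _ Dp); rewrite [X in _ <= X]Jmin; last exact: ST.
  by rewrite lerDl addr_ge0 ?sqr_ge0.
(* At [x n] the functional of [T m] is at most that of [T n], whose value there is [j n], and it
   exceeds its own minimum [j m] by the squared graph distance to [x m]. *)
have jdist m n : (m <= n)%N ->
    rn (x n - x m) ^+ 2 + rn (T m (x n) - T m (x m)) ^+ 2 <= j n - j m.
  move=> mn; have := Jle _ _ _ mn (Dx n).
  by rewrite Jmin; [rewrite /j; lra|exact: subT mn _ (Dx n)].
have jnd : nondecreasing_seq j.
  move=> m n mn; rewrite -subr_ge0; apply: le_trans (jdist _ _ mn).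
  by rewrite addr_ge0 ?sqr_ge0.
have jcau e : 0 < e -> exists N, forall m n, (N <= m)%N -> (m <= n)%N ->
    j n - j m < e.
  exact: bounded_mono_cauchy jnd jS.
have lt_sqr (a e : R) : 0 < e -> 0 <= a -> a ^+ 2 < e ^+ 2 -> a < e.
  by move=> e0 a0; rewrite ltr_pXn2r ?nnegrE // ltW.
have [phi xphi] : exists phi : H, x n @[n --> \oo] --> phi.
  apply: cauchyn_cvg => e e0; have [N hN] := jcau _ (exprn_gt0 2 e0).
  have main m n : (N <= m)%N -> (m <= n)%N -> rn (x n - x m) < e.
    move=> Nm mn; apply: lt_sqr; rewrite ?rn_ge0 //.
    apply: le_lt_trans (hN _ _ Nm mn); apply: le_trans (jdist _ _ mn).
    by rewrite lerDl sqr_ge0.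
  exists N => m n Nm Nn; have [mn|nm] := leqP m n; first by rewrite rnB main.
  by rewrite main // ltnW.
have Tphi m : odom (T m) phi /\ T m (x n) @[n --> \oo] --> T m phi.
  (* The index is shifted by [m] so that all terms lie in the domain of [T m]. *)
  have [w Tw] : exists w : K m, T m (x (n + m)%N) @[n --> \oo] --> w.
    apply: (cauchyn_cvg (u := fun n => T m (x (n + m)%N))) => e e0.
    have [N hN] := jcau _ (exprn_gt0 2 e0).
    have main k n : (N <= k)%N -> (k <= n)%N ->
        rn (T m (x (n + m)%N) - T m (x (k + m)%N)) < e.
      move=> Nk kn.
      have km : (N <= k + m)%N by rewrite (leq_trans Nk) ?leq_addr.
      have kn' : (k + m <= n + m)%N by rewrite leq_add2r.
      apply: lt_sqr; rewrite ?rn_ge0 //.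
      apply: le_lt_trans (hN _ _ km kn'); apply: le_trans (jdist _ _ kn').
      have D1 := Dx (k + m)%N; have D2 := subT kn' (Dx (n + m)%N).
      have mk : (m <= k + m)%N by rewrite leq_addl.
      rewrite -!opB //; try exact: (subT mk).
      apply: ler_wpDl; first exact: sqr_ge0.
      rewrite ler_pXn2r ?nnegrE ?rn_ge0 //; apply: leT => //.
      exact: (lin_subsetB (linT _).1).
    exists N => k n Nk Nn; have [kn|nk] := leqP k n; first by rewrite rnB main.
    by rewrite main // ltnW.
  have [/= Dphi wE] : graph (T m) (phi, w).
    apply: clT; apply/closure_graphP; exists (fun n => x (n + m)%N); split=> //.
      by move=> n; apply: (subT (leq_addl n m)).
    move/cvgnP : xphi => xphi; apply/cvgnP => e /xphi[N hN].
    by exists N => n nN; apply: hN; rewrite (leq_trans nN) ?leq_addr.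
  split=> //; rewrite -wE; move/cvgnP : Tw => Tw; apply/cvgnP => e /Tw[N hN].
  exists (N + m)%N => n nN.
  have mn : (m <= n)%N by rewrite (leq_trans _ nN) ?leq_addl.
  by rewrite -(subnK mn); apply: hN; rewrite leq_subRL // addnC.
(* The limit in [n] is taken with [m] fixed; the bound obtained is uniform in [m], which will put
   [phi] in the domain of [S]. *)
have Jphi m : J (T m) f phi <= J S f p.1.
  have sq (b : nat -> R) (l : R) : b n @[n --> \oo] --> l ->
      b n ^+ 2 @[n --> \oo] --> l ^+ 2.
    by move=> bl; exact: (@cvgM _ _ _ _ b b l l bl bl).
  have l1 : J (T m) f (x n) @[n --> \oo] --> J (T m) f phi.
    apply: cvgB.
      exact: cvgD (sq _ _ (cvg_rn xphi)) (sq _ _ (cvg_rn (Tphi m).2)).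
    apply: cvgM; first exact: cvg_cst.
    exact: cvg_Re (cvg_dot (cvgn_cst f) xphi).
  apply: (cvg_real_le l1); exists m => n mn.
  exact: le_trans (Jle _ _ _ mn (Dx n)) (jS n).
have Lphi : odom S phi.
  rewrite domS; split=> [n|]; first exact: (Tphi n).1.
  pose B := J S f p.1 + 2 * Re '[f, phi] + 1.
  exists (`|B| + 1) => n.
  have := Jphi n; rewrite /J -/(J S f p.1) => h.
  have h2 : rn (T n phi) ^+ 2 <= `|B|.
    apply: le_trans (ler_norm _); rewrite /B; have := sqr_ge0 (rn phi).
    move: h; rewrite /J; lra.
  have := sqr_ge0 (rn (T n phi) - 1); have := normr_ge0 B; move: h2.
  move: (rn _) (`|_|) => a b; nra.
have JSphi : J S f phi <= J S f p.1.
  have Lphi' := Lphi; rewrite domS in Lphi'.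
  have -> : J S f phi = rn (S phi) ^+ 2 + (rn phi ^+ 2 - 2 * Re '[f, phi]).
    by rewrite /J; ring.
  rewrite -lerBrDr; apply: (cvg_real_le (limS Lphi')); exists 0%N => n _.
  by have := Jphi n; rewrite /J; lra.
(* The value at [phi] does not exceed the minimum, so the squared distance in [J_min] vanishes. *)
have phiE : phi = p.1.
  have := J_min linS Dp Lphi fP => e.
  apply/eqP; rewrite -subr_eq0; apply/eqP/rn_eq0/eqP; rewrite -sqrf_eq0.
  rewrite eq_le sqr_ge0 andbT; move: JSphi; rewrite e.
  have := sqr_ge0 (rn (S phi - S p.1)); lra.
exists (fun n => (x n, f + (c - 1)%:C *: x n)); first by move=> n; case: (xP n).
rewrite phiE in xphi.
rewrite [p]surjective_pairing; apply: cvg_pair => //.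
have -> : p.2 = (c - 1)%:C *: p.1 + f by rewrite addrC subrK.
by under eq_fun do rewrite addrC; exact: (cvgn_comb xphi (cvgn_cst f)).
Qed.

End GraphConvergence.

(** * Order and limits of forms in terms of their operators *)

Section RepresentedOrder.
Variables (R : realType) (H : hilbertType R) (c : R).

(** With a common [c] the terms in [|phi|^2] cancel, so the order of forms is a comparison of
    operator values in norm. *)
Lemma rep_le (K1 K2 : hilbertType R) (t1 t2 : sesqform H)
    (Q1 : operator H K1) (Q2 : operator H K2) :
  represents t1 c Q1 -> represents t2 c Q2 ->
  form_le t1 t2 <-> odom Q2 `<=` odom Q1 /\
    forall phi, odom Q2 phi -> rn (Q1 phi) <= rn (Q2 phi).
Proof.
move=> r1 r2; rewrite /form_le r1.1 r2.1.
split=> -[sub le12]; split=> // phi Dphi; have D1 := sub _ Dphi.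
  have := le12 _ Dphi; rewrite (rep_sqr r1) // (rep_sqr r2) // lecR lerD2l.
  by rewrite ler_pXn2r ?nnegrE ?rn_ge0.
rewrite (rep_sqr r1) // (rep_sqr r2) // lecR lerD2l.
by rewrite ler_pXn2r ?nnegrE ?rn_ge0 // le12.
Qed.

Variables (K : nat -> hilbertType R) (t_ : nat -> sesqform H).
Variable Q_ : forall n, operator H (K n).
Hypothesis rep_ : forall n, represents (t_ n) c (Q_ n).

Lemma rep_sup_finite phi : (forall n, odom (Q_ n) phi) ->
  sup_finite t_ phi <-> exists M : R, forall n, rn (Q_ n phi) <= M.
Proof.
move=> Dphi; split=> -[M hM].
  (* A bound on the square [d^2] bounds [d] through [2 d <= d^2 + 1]. *)
  exists (`|M - c * rn phi ^+ 2| + 1) => n.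
  have := hM n; rewrite (rep_sqr (rep_ n)) // lecR => h.
  have := ler_norm (M - c * rn phi ^+ 2).
  have := sqr_ge0 (rn (Q_ n phi) - 1); move: h.
  move: (c * _) (`|_|) (rn (Q_ n phi)) => a b d; nra.
exists (c * rn phi ^+ 2 + M ^+ 2) => n.
rewrite (rep_sqr (rep_ n)) // lecR lerD2l ler_pXn2r ?nnegrE ?rn_ge0 //.
exact: le_trans (rn_ge0 _) (hM n).
Qed.

Lemma rep_increases (Ks : hilbertType R) (s : sesqform H)
    (S : operator H Ks) phi : represents s c S ->
  (forall n, odom (Q_ n) phi) -> odom S phi ->
  (forall m n, (m <= n)%N -> rn (Q_ m phi) <= rn (Q_ n phi)) ->
  rn (Q_ n phi) ^+ 2 @[n --> \oo] --> rn (S phi) ^+ 2 ->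
  increases_to (fun n => t_ n phi phi) (s phi phi).
Proof.
move=> sS DQ DS leQ lim; split=> [m n mn|].
  rewrite (rep_sqr (rep_ m)) // (rep_sqr (rep_ n)) // lecR lerD2l.
  by rewrite ler_pXn2r ?nnegrE ?rn_ge0 // leQ.
have e n : (t_ n phi phi : R[i]^o) =
    (c * rn phi ^+ 2 + rn (Q_ n phi) ^+ 2)%:C by exact: rep_sqr.
rewrite (eq_cvg _ _ e) (rep_sqr sS) //; apply: cvg_real.
exact: cvgD (cvgn_cst _) lim.
Qed.

Lemma rep_limit_le (K' : hilbertType R) (t : sesqform H) (Q : operator H K') :
  represents t c Q -> is_form_limit t_ t -> forall n, form_le (t_ n) t.
Proof.
move=> tQ [_ tdom tlim] n; have sub : fdom t `<=` fdom (t_ n).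
  by rewrite tdom => phi [/(_ n I)].
split=> // phi Dphi; have [mono lim] := tlim _ Dphi.
have Dn m : odom (Q_ m) phi.
  by rewrite -(rep_ m).1; move: Dphi; rewrite tdom => -[/(_ m I)].
have DQ : odom Q phi by rewrite -tQ.1.
rewrite (rep_sqr (rep_ n)) // (rep_sqr tQ) // lecR.
have := cvg_Re lim; rewrite (rep_sqr tQ) //=.
move=> /(cvg_real_le2 (cvgn_cst _)); apply; exists n => m nm.
have := mono _ _ nm; rewrite (rep_sqr (rep_ n)) // (rep_sqr (rep_ m)) //.
by rewrite lecR.
Qed.

End RepresentedOrder.

(** A sequence converging in the graph norm of [Q2] is Cauchy for [Q1]; closability of [Q1]
    identifies the limit, and the inequality of norms is preserved. *)
Lemma clop_mono (R : realType) (H K1 K2 : hilbertType R) (Q1 : operator H K1)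
    (Q2 : operator H K2) : linear_op Q1 -> linear_op Q2 ->
  closable_op Q1 -> odom Q2 `<=` odom Q1 ->
  (forall phi, odom Q2 phi -> rn (Q1 phi) <= rn (Q2 phi)) ->
  odom (clop Q2) `<=` odom (clop Q1) /\
  forall phi, odom (clop Q2) phi -> rn (clop Q1 phi) <= rn (clop Q2 phi).
Proof.
move=> lin1 lin2 cl1 sub le12.
suff main phi : odom (clop Q2) phi ->
    odom (clop Q1) phi /\ rn (clop Q1 phi) <= rn (clop Q2 phi).
  by split=> phi /main[].
move=> /clop_approx[u [Du up Qu]].
have [w Q1w] : exists w : K1, Q1 (u n) @[n --> \oo] --> w.
  apply: (cauchyn_cvg (u := fun n => Q1 (u n))) => e e0.
  have [N hN] := cvg_cauchyn Qu e0.
  exists N => m n Nm Nn; apply: le_lt_trans (hN m n Nm Nn).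
  rewrite -!opB //; try exact: sub.
  by apply: le12; exact: (lin_subsetB lin2.1).
have cw : closure (graph Q1) (phi, w).
  by apply/closure_graphP; exists u; split=> // n; exact: sub.
have [D1 ->] := clop_eq lin1 cl1 cw; split=> //.
apply: (cvg_real_le2 (cvg_rn Q1w) (cvg_rn Qu)).
by exists 0%N => n _; exact: le12.
Qed.

Lemma restriction_closable (R : realType) (H K : hilbertType R)
    (Q S : operator H K) : linear_op Q -> linear_op S -> closed_op S ->
  graph Q `<=` graph S -> closable_op Q.
Proof.
move=> linQ linS clS QS; apply/seteqP; split=> [w cw|_ ->]; last first.
  exact: closure_graph0.
have [_ /= ->] : graph S (0, w) by apply: clS; exact: closureS QS _ cw.
by rewrite op0.
Qed.

(** * Regular parts, closures and relations of a nondecreasing sequence of forms *)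

Theorem theorem7p2 (R : realType) (H : hilbertType R)
    (t_ : nat -> sesqform H) (t : sesqform H) (c : R)
    (K_ : nat -> hilbertType R) (Q_ : forall n, operator H (K_ n))
    (K : hilbertType R) (Q : operator H K) :
  (forall n, semibounded (t_ n)) ->
  (forall m n, (m <= n)%N -> form_le (t_ m) (t_ n)) ->
  lower_bound c (t_ 0%N) ->
  (forall n, linear_op (Q_ n)) ->
  (forall n, represents (t_ n) c (Q_ n)) ->
  is_form_limit t_ t ->
  linear_op Q ->
  represents t c Q ->
  let r_ n := reg_form c (Q_ n) in
  let treg := reg_form c Q in
  (forall m n, (m <= n)%N -> form_le (r_ m) (r_ n)) /\
  (forall n, form_le (r_ n) treg) /\
  exists tr : sesqform H,
    [/\ semibounded tr, closable_form tr,
        exists (Kr : hilbertType R) (Qr : operator H Kr),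
          [/\ linear_op Qr, closable_op Qr & represents tr c Qr],
        fdom tr =
          [set phi | (\bigcap_n fdom (t_ n)) phi /\ sup_finite r_ phi]
      & [/\ forall n, form_le (r_ n) tr, form_le tr treg
          & forall phi, fdom tr phi ->
              increases_to (fun n => r_ n phi phi) (tr phi phi)]] /\
  (forall m n, (m <= n)%N -> form_le (clos (r_ m)) (clos (r_ n))) /\
  (forall n, form_le (clos (r_ n)) (clos tr)) /\
  exists sr : sesqform H,
    [/\ semibounded sr, closed_form sr,
        exists (Ks : hilbertType R) (Sr : operator H Ks),
          [/\ linear_op Sr, closed_op Sr & represents sr c Sr],
        fdom sr =
          [set phi | (\bigcap_n fdom (clos (r_ n))) phi /\
                     sup_finite (fun n => clos (r_ n)) phi]
      & [/\ forall n, form_le (clos (r_ n)) sr, form_le sr (clos tr),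
            forall phi, fdom sr phi ->
              increases_to (fun n => clos (r_ n) phi phi) (sr phi phi)
          & form_ext (clos tr) sr]] /\
    [/\ forall n, semibounded_rel (form_rel (t_ n)),
        semibounded_rel (closed_form_rel sr),
        strong_resolvent_cvg (fun n => form_rel (t_ n)) (closed_form_rel sr)
      & strong_graph_cvg (fun n => form_rel (t_ n)) (closed_form_rel sr)].
Proof.
move=> _ t_le _ linQ_ rep_ t_lim linQ tQ r_ treg.
have leQ m n : (m <= n)%N -> odom (Q_ n) `<=` odom (Q_ m) /\
    forall phi, odom (Q_ n) phi -> rn (Q_ m phi) <= rn (Q_ n phi).
  by move=> mn; apply/(rep_le (rep_ m) (rep_ n)); exact: t_le.
have leQt n : odom Q `<=` odom (Q_ n) /\
    forall phi, odom Q phi -> rn (Q_ n phi) <= rn (Q phi).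
  apply/(rep_le (rep_ n) tQ); exact: (rep_limit_le rep_ tQ t_lim).
pose Rg n := reg_op (Q_ n).
have linR n : linear_op (Rg n) by exact: reg_linear.
have clR n : closable_op (Rg n) by exact: reg_closable.
have repR n : represents (r_ n) c (Rg n) by exact: op_form_rep.
have repreg : represents treg c (reg_op Q) by exact: op_form_rep.
have leR m n : (m <= n)%N -> odom (Rg n) `<=` odom (Rg m) /\
    forall phi, odom (Rg n) phi -> rn (Rg m phi) <= rn (Rg n phi).
  move=> mn; have [sub le] := leQ _ _ mn; split=> //.
  exact: (reg_mono (linQ_ m) (linQ_ n) sub le).
have leRt n : odom (reg_op Q) `<=` odom (Rg n) /\
    forall phi, odom (reg_op Q) phi -> rn (Rg n phi) <= rn (reg_op Q phi).
  have [sub le] := leQt n; split=> //.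
  exact: (reg_mono (linQ_ n) linQ sub le).
pose T n := clop (Rg n).
have linT n : linear_op (T n) by exact: clop_linear.
have clT n : closed_op (T n) by exact: clop_closed.
have repT n : represents (clos (r_ n)) c (T n) by exact: clos_rep.
have leT m n : (m <= n)%N -> odom (T n) `<=` odom (T m) /\
    forall phi, odom (T n) phi -> rn (T m phi) <= rn (T n phi).
  by move=> mn; have [sub le] := leR _ _ mn; exact: clop_mono.
have subT m n (mn : (m <= n)%N) := (leT m n mn).1.
have leT' m n phi (mn : (m <= n)%N) := (leT m n mn).2 phi.
have [Ks [S [linS domS limS]]] := monotone_limit linT subT leT'.
have TR n phi : odom (Rg n) phi -> odom (T n) phi /\ T n phi = Rg n phi.
  exact: clop_ext.
have clS : closed_op S by exact: (limit_closed linT leT' linS domS limS clT).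
pose sr := op_form c S; have repS : represents sr c S by exact: op_form_rep.
have leS n : odom S `<=` odom (T n) /\
    forall phi, odom S phi -> rn (T n phi) <= rn (S phi).
  split=> [phi|phi]; first by rewrite domS => -[].
  exact: (limit_ge leT' domS limS).
pose Qr := Operator [set phi | (forall n, odom (Rg n) phi) /\ odom S phi] S.
have linQr : linear_op Qr.
  split=> [|a u v [_ Su] [_ Sv]]; last exact: (linS.2 a u v Su Sv).
  split=> [|a u v [Du Su] [Dv Sv]].
    split=> [n|]; [exact: (lin_subset0 (linR n).1)|exact: (lin_subset0 linS.1)].
  by split=> [n|]; [exact: (linR n).1.2|exact: linS.1.2].
have clQr : closable_op Qr.
  by apply: (restriction_closable linQr linS clS) => -[x y] [[_ /= Sx] /= ->].
pose tr := op_form c Qr; have repr : represents tr c Qr by exact: op_form_rep.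
have leQr n : odom Qr `<=` odom (Rg n) /\
    forall phi, odom Qr phi -> rn (Rg n phi) <= rn (Qr phi).
  split=> [phi [Dphi _] //|phi [Dphi Sphi]].
  by rewrite -(TR n phi (Dphi n)).2; exact: (leS n).2.
(* On [dom t_n] the closure [T n] has the values of the regular part, so membership in the domain of
   [S] reads as boundedness of the regular parts themselves. *)
have reg_lim phi : (forall n, odom (Rg n) phi) ->
    odom S phi <-> exists M : R, forall n, rn (Rg n phi) <= M.
  move=> Dphi; rewrite domS; split=> [[_ [M hM]]|[M hM]].
    by exists M => n; rewrite -(TR n phi (Dphi n)).2.
  split=> [n|]; first exact: (TR n phi (Dphi n)).1.
  by exists M => n; rewrite (TR n phi (Dphi n)).2.
have sQr : form_ext tr sr by split=> [phi []|].
have srsb := rep_semibounded linS repS; have srcl := rep_closed linS repS clS.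
have [_ _ trE min] : is_closure tr (clos tr).
  exact: (xgetPex tr (ex_intro _ _ (op_form_closure c linQr clQr))).
(* [sr] is a closed extension of [tr], so minimality of the closure gives both the restriction
   property and the inequality between [sr] and [clos tr]. *)
have ext := min _ srsb srcl sQr.
have relT n : form_rel (t_ n) = form_graph c (T n).
  by rewrite (form_relE (linQ_ n) (rep_ n)) form_graph_reg.
have relS : closed_form_rel sr = form_graph c S by exact: closed_form_relE.
have graphcvg :
    strong_graph_cvg (fun n => form_rel (t_ n)) (closed_form_rel sr).
  split=> [n||p].
  - by rewrite relT; exact: form_graph_selfadjoint.
  - by rewrite relS; exact: form_graph_selfadjoint.
  rewrite relS => /(form_graph_cvg linT clT subT leT' linS domS limS)[u uT up].
  by exists u => // n; rewrite relT.
split=> [m n mn|]; first exact/(rep_le (repR m) (repR n))/leR.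
split=> [n|]; first exact/(rep_le (repR n) repreg)/leRt.
exists tr; split; [split|split; [|split]].
- exact: rep_semibounded linQr repr.
- exact: rep_closable linQr repr clQr.
- by exists Ks, Qr.
- apply/seteqP; split=> phi /=.
    move=> [Dphi Sphi]; split.
      by move=> n _; rewrite (rep_ n).1; exact: Dphi.
    by apply/(rep_sup_finite repR) => //; exact/reg_lim.
  move=> [Dphi supphi]; have DR n : odom (Rg n) phi.
    by move: (Dphi n I); rewrite (rep_ n).1.
  split=> //; apply/(reg_lim _ DR); exact/(rep_sup_finite repR).
- split=> [n||phi [Dphi Sphi]]; first exact/(rep_le (repR n) repr).
    (* Monotonicity of regular parts, applied to [t_n <= t], makes [|reg_op Q phi|] a bound for all
       [n], and the limit inherits it. *)
    apply/(rep_le repr repreg); have D phi : odom (reg_op Q) phi -> odom Qr phi.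
      move=> Dphi; have Dn n : odom (Rg n) phi by exact: (leRt n).1.
      split=> //; apply/(reg_lim _ Dn); exists (rn (reg_op Q phi)) => n.
      exact: (leRt n).2.
    split=> // phi Dphi; have [Dn Sphi] := D _ Dphi.
    apply: (limit_le domS limS Sphi) => n; rewrite (TR n phi (Dn n)).2.
    exact: (leRt n).2.
  apply: (rep_increases repR repr) => // [m n mn|]; first exact: (leR m n mn).2.
  have e n : rn (Rg n phi) ^+ 2 = rn (T n phi) ^+ 2.
    by rewrite (TR n phi (Dphi n)).2.
  by rewrite (eq_cvg _ _ e); apply: limS; rewrite -domS.
- by move=> m n mn; apply/(rep_le (repT m) (repT n)); exact: leT.
- move=> n; apply/(rep_le (repT n) (clos_rep c linQr clQr)).
  by have [sub le] := leQr n; exact: clop_mono.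
exists sr; split; [split|split].
- exact: srsb.
- exact: srcl.
- by exists Ks, S.
- rewrite [LHS]domS; apply/seteqP; split=> phi /=.
    move=> [Dphi bphi]; split; first by move=> n _; rewrite (repT n).1.
    exact/(rep_sup_finite repT).
  move=> [Dphi supphi]; have DT n : odom (T n) phi.
    by move: (Dphi n I); rewrite (repT n).1.
  by split=> //; exact/(rep_sup_finite repT).
- split=> [n||phi Sphi|]; [exact/(rep_le (repT n) repS)| | |exact: ext].
    split; first exact: ext.1.
    by move=> phi Dphi; rewrite ext.2.
  have Lphi : limit_dom T phi by rewrite -domS.
  apply: (rep_increases repT repS) => // [n|m n mn|]; first exact: (leS n).1.
    by apply: (leT' _ _ _ mn); exact: (leS n).1.
  exact: limS.
- by move=> n; rewrite relT; exact: form_graph_semibounded.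
- by rewrite relS; exact: form_graph_semibounded.
- exact: graph_resolvent_cvg.
- exact: graphcvg.
Qed.
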